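(* Let $X \subset \mathbb{P}^3$ be a smooth quartic surface over $\mathbb{C}$ and let $l', l''$ be two disjoint lines on $X$. Then the following conditions are equivalent: (a) $l'$ and $l''$ are twin lines; (b) there exists a non-symplectic symmetry $\tau\colon X \rightarrow X$ of order $2$ such that $\mathrm{Fix}(\tau,X) = \mathrm{Fix}(\tau,\mathbb{P}^3) = l' \cup l''$.
   Context: All varieties are defined over $\mathbb{C}$. A symmetry of a smooth quartic surface $X \subset \mathbb{P}^3$ is an automorphism of $X$ which is the restriction of an automorphism of $\mathbb{P}^3$; the corresponding automorphism of $\mathbb{P}^3$ is denoted by the same letter. A symmetry is symplectic if it acts trivially on $H^{2,0}(X)$, and non-symplectic otherwise. $\mathrm{Fix}(\tau,X)$ and $\mathrm{Fix}(\tau,\mathbb{P}^3)$ denote the fixed loci (sets of fixed points) of $\tau$ acting on $X$ and on $\mathbb{P}^3$, respectively. Two disjoint lines $l', l''$ on $X$ are called twin lines if there exist $10$ other distinct lines on $X$ each of which intersects both $l'$ and $l''$. *)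

(* Defs.v *)
(* MathComp + MathComp-Analysis; the notations of mpoly clash with those of
   MathComp-Analysis, hence are not imported. *)
From HB Require Import structures.
From mathcomp Require Import all_boot all_order all_algebra.
From mathcomp Require Import complex reals.
From mathcomp Require Import -(notations) mpoly.
From mathcomp Require Import boolp classical_sets topology normedtype derive.

Set Implicit Arguments.
Unset Strict Implicit.
Unset Printing Implicit Defensive.

Import Order.TTheory GRing.Theory Num.Theory.
Import numFieldNormedType.Exports.

Local Open Scope classical_set_scope.
Local Open Scope ring_scope.

Definition Cplx (R : realType) : numClosedFieldType := R[i].

(* A point (resp. line) of P^3 is a linear subspace of K^4 of dimension 1
   (resp. 2). *)
Definition P3_point (K : fieldType) := {p : {vspace 'rV[K]_4} | \dim p == 1%N}.
Definition P3_line (K : fieldType) := {l : {vspace 'rV[K]_4} | \dim l == 2%N}.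

Definition line_points (K : fieldType) (l : P3_line K) : set (P3_point K) :=
  [set p : P3_point K | (val p <= val l)%VS].

Definition lines_meet (K : fieldType) (l m : P3_line K) : Prop :=
  line_points l `&` line_points m !=set0.

Definition heval (K : comNzRingType) (F : mpoly 4 K) (v : 'rV[K]_4) : K :=
  meval (fun i => v 0 i) F.

Definition partial (K : comNzRingType) (i : 'I_4) (F : mpoly 4 K) :
  mpoly 4 K := mderiv i F.

Definition surface (K : fieldType) (F : mpoly 4 K) : set (P3_point K) :=
  [set p : P3_point K | forall v : 'rV[K]_4, v \in val p -> heval F v = 0].

(* By the Jacobian criterion; this forces F to be nonzero. *)
Definition smooth_quartic (K : fieldType) (F : mpoly 4 K) : Prop :=
  F \is ishomog1 4 mdeg /\
  forall v : 'rV[K]_4, v != 0 -> heval F v = 0 ->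
    exists i, heval (partial i F) v != 0.

Definition twin_lines (K : fieldType) (X : set (P3_point K))
    (l1 l2 : P3_line K) : Prop :=
  [/\ line_points l1 `<=` X, line_points l2 `<=` X, ~ lines_meet l1 l2 &
      exists s : 10.-tuple (P3_line K),
        uniq s /\
        forall m, m \in s ->
          [/\ m != l1, m != l2, line_points m `<=` X,
              lines_meet m l1 & lines_meet m l2]].

(* [is_lift A tau]: tau is the automorphism of P^3 given by the class of A in
   PGL_4 = Aut(P^3). *)
Definition is_lift (K : fieldType) (A : 'M[K]_4)
    (tau : P3_point K -> P3_point K) : Prop :=
  A \in unitmx /\
  forall (p : P3_point K) (v : 'rV[K]_4), v \in val p -> v *m A \in val (tau p).

(* Both the symmetry of X and the corresponding automorphism of P^3 are
   represented by the latter. *)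
Definition symmetry (K : fieldType) (X : set (P3_point K))
    (tau : P3_point K -> P3_point K) : Prop :=
  (exists A, is_lift A tau) /\ tau @` X = X.

Definition has_order2 (K : fieldType) (X : set (P3_point K))
    (tau : P3_point K -> P3_point K) : Prop :=
  (forall p, X p -> tau (tau p) = p) /\ (exists2 p, X p & tau p <> p).

Definition Fix (K : fieldType) (tau : P3_point K -> P3_point K)
  (S : set (P3_point K)) : set (P3_point K) := [set p | S p /\ tau p = p].

Section Forms.
(* Stated over K : numFieldType, which carries the topology of its norm; to be
   used with K = Cplx R. *)
Variable K : numFieldType.
Implicit Types (F : mpoly 4 K) (v a b : 'rV[K]_4).

(* The punctured affine cone over X = {F = 0}, and its tangent space at v. *)
Definition cone F : set 'rV[K]_4 := [set v | v != 0 /\ heval F v = 0].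

Definition cone_tangent F v : set 'rV[K]_4 :=
  [set a | \sum_(i < 4) a 0 i * heval (partial i F) v = 0].

Definition holomorphic_near (f : 'rV[K]_4 -> K) v : Prop :=
  \forall u \near v, differentiable (f : 'rV[K]_4 -> K^o) u.

(* A holomorphic 2-form on X, i.e. an element of H^{2,0}(X), is encoded by its
   pullback to the punctured cone along v |-> [v]: w v a b is the value at [v]
   on the images of a and b in T_[v] X = cone_tangent F v / <v>.  The forms on
   the cone that descend to X are those killed by contraction with the radial
   vector v and invariant under scaling.  Holomorphy means being locally the
   restriction of some \sum_(i < j) f_ij dx_i /\ dx_j with f_ij holomorphic on
   an open subset of C^4; this includes that w v is bilinear and alternating.
   The values of w outside the cone and its tangent spaces are irrelevant. *)
Definition holomorphic_2form F
    (w : 'rV[K]_4 -> 'rV[K]_4 -> 'rV[K]_4 -> K) : Prop :=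
  [/\ forall v0, cone F v0 ->
        exists f : 'I_4 -> 'I_4 -> 'rV[K]_4 -> K,
          (forall i j, holomorphic_near (f i j) v0) /\
          \forall v \near v0, cone F v ->
            forall a b, cone_tangent F v a -> cone_tangent F v b ->
              w v a b = \sum_(i < 4) \sum_(j < 4 | (i < j)%N)
                          f i j v * (a 0 i * b 0 j - a 0 j * b 0 i),
      forall v b, cone F v -> cone_tangent F v b -> w v v b = 0 &
      forall (k : K) v a b, k != 0 -> cone F v ->
        cone_tangent F v a -> cone_tangent F v b ->
        w (k *: v) (k *: a) (k *: b) = w v a b].

(* tau^* w = w for all w in H^{2,0}(X); by scaling invariance tau^* w does not
   depend on the lift A. *)
Definition symplectic F (tau : P3_point K -> P3_point K) : Prop :=
  forall A, is_lift A tau -> forall w, holomorphic_2form F w ->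
    forall v a b, cone F v -> cone_tangent F v a -> cone_tangent F v b ->
      w (v *m A) (a *m A) (b *m A) = w v a b.

End Forms.

(* Main.v *)
Require Import Defs.
From mathcomp Require Import all_boot all_order all_algebra separable.
From mathcomp Require Import ring zify.
From mathcomp Require Import -(notations) mpoly.
From mathcomp Require Import boolp classical_sets functions reals topology normedtype derive.

Set Implicit Arguments.
Unset Strict Implicit.
Unset Printing Implicit Defensive.

Import Order.TTheory GRing.Theory Num.Theory.
Import numFieldNormedType.Exports.

Local Open Scope classical_set_scope.
Local Open Scope ring_scope.

(** Take coordinates (x, y, z, w) with l1 = {z = w = 0} and l2 = {x = y = 0}.
    Since the quartic F vanishes on both lines, it is the sum of three forms of
    bidegrees (3,1), (2,2) and (1,3) in (x, y) and (z, w):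
      F = F31 + F22 + F13 (splits, quartic_splits),
    with F31 = A z + B w for two cubics A, B in (x, y).  Both conditions of the
    theorem turn out to be equivalent to F22 = 0.

    The line joining p in l1 to q in l2 lies on the surface iff the three forms
    vanish at (p, q).  Smoothness along l1 says that A and B have no common zero,
    so F31 = 0 forces q = (-B(p), A(p)): through every p there is one candidate
    line only (transversal).

    If F22 = 0, the involution of matrix diag(1, 1, -1, -1) maps F to -F, hence
    preserves the surface; its fixed points are those of l1 and l2.  It is not
    symplectic: the residue of the rational form Omega / F is a holomorphic
    2-form on the surface (residue, residue_holomorphic), and it changes sign
    because F does while the determinant is 1 (residue_pullback).  Conversely,
    an involution with this fixed locus is scalar on each of the two planes
    carrying l1 and l2, with opposite eigenvalues, so that the zero set of F is
    stable under (x, y, z, w) |-> (x, y, -z, -w) (involution_invariant).  On the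
    line through p and q, away from p and q, F is a quadratic polynomial of
    coefficients F31, F22, F13, whose roots are then stable under t |-> -t; this
    gives F22 F31 = 0 everywhere and then F22 = 0 (form22_eq0_of_invariant).

    If there are ten transversal lines, then F22(p, (-B(p), A(p))), a binary
    form of degree 8, has ten zeros and is zero; F22 = 0 follows as A and B are
    coprime of degree 3 (coprime_syzygy, twin_form22_eq0).  If F22 = 0, the
    transversals on the surface correspond to the zeros of the binary form
    G(p) = F13(p, (-B(p), A(p))) of degree 10.  A double zero of G yields a
    singular point of the surface (resultant_simple), so G has exactly ten zeros
    (twin_of_odd). *)

(** * Polynomial functions and directional derivatives *)

(** Reduces an equality that holds modulo a relation h = 0 to a ring identity
    exhibiting the cofactor a. *)
Lemma eq_of_multiple (K : pzRingType) (a h x y : K) : h = 0 -> x - y = a * h -> x = y.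
Proof. by move=> ->; rewrite mulr0 => /subr0_eq. Qed.

Definition evalE := (hornerD, hornerN, hornerZ, hornerM, horner_exp, hornerXn,
  hornerX, hornerC, hornerMn, horner0).

Lemma horner_inj (K : numFieldType) (p q : {poly K}) :
  (forall t, p.[t] = q.[t]) -> p = q.
Proof.
move=> h; apply/eqP; rewrite -subr_eq0; apply/eqP/(@roots_geq_poly_eq0 _ _
  [seq i%:R | i <- iota 0 (size (p - q))]); last by rewrite size_map size_iota.
- by apply/allP => x _; rewrite rootE hornerD hornerN h subrr.
- by rewrite map_inj_uniq ?iota_uniq // => i j /eqP; rewrite eqr_nat => /eqP.
Qed.

Lemma coefM_top (R : nzRingType) (p q : {poly R}) m n :
  (size p <= m.+1)%N -> (size q <= n.+1)%N ->
  (size (p * q)%R <= (m + n).+1)%N /\ (p * q)`_(m + n) = p`_m * q`_n.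
Proof.
move=> sp sq; split.
  by apply: leq_trans (size_polyMleq _ _) _; lia.
have hm : (m < (m + n).+1)%N by lia.
rewrite coefM (bigD1 (Ordinal hm)) //= big1 ?addr0 ?addKn // => i im.
have {}im : nat_of_ord i <> m by apply/eqP.
have [lt|ge] := ltnP i m; last first.
  by rewrite [p`_ _]nth_default ?mul0r //; apply: leq_trans sp _; lia.
by rewrite [q`_ _]nth_default ?mulr0 //; apply: leq_trans sq _; lia.
Qed.

(** Spelled as in the definition of cone_tangent, which thereby is the kernel of
    dirD F v. *)
Definition dirD (K : comNzRingType) (F : mpoly 4 K) (v c : 'rV[K]_4) : K :=
  \sum_(i < 4) c 0 i * heval (partial i F) v.

Section Directional.
Variables (K : numFieldType) (v c : 'rV[K]_4).

Let restricts (F : mpoly 4 K) (p : {poly K}) :=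
  (forall t, p.[t] = heval F (v + t *: c)) /\ p^`().[0] = dirD F v c.

Let restrictsM F G p q :
  restricts F p -> restricts G q -> restricts (F * G) (p * q).
Proof.
move=> [hp dp] [hq dq]; split=> [t|]; first by rewrite hornerM hp hq /heval mevalM.
rewrite derivM hornerD !hornerM dp dq hp hq scale0r addr0.
rewrite mulr_suml mulr_sumr -big_split; apply: eq_bigr => i _ /=.
by rewrite /heval /partial mderivM mevalD !mevalM; ring.
Qed.

Let restrictsXn i k : exists p, restricts (mpolyX K (mnm1 i) ^+ k) p.
Proof.
elim: k => [|k [p hp]].
  exists 1; rewrite expr0; split=> [t|]; first by rewrite hornerC /heval meval1.
  rewrite derivC horner0 /dirD big1 // => j _.
  by rewrite /partial /heval -mpolyC1 mderivC meval0 mulr0.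
exists (((v 0 i)%:P + c 0 i *: 'X) * p); rewrite exprS; apply: restrictsM => //.
split=> [t|].
  by rewrite /heval mevalXU !mxE !hornerE mulrC.
rewrite derivD derivC derivZ derivX !hornerE /dirD (bigD1 i) //= big1 ?addr0.
  rewrite /partial /heval mderivX mnmE eqxx scale1r.
  have -> : (mnm_sub (mnm1 i) (mnm1 i)) = mnm0 by apply/mnmP => j; rewrite !mnmE subnn.
  by rewrite mpolyX0 meval1 mulr1.
by move=> j ji; rewrite /partial /heval mderivX mnmE eq_sym (negbTE ji) scale0r meval0 mulr0.
Qed.

(** The Leibniz rule on both sides propagates this from the coordinates to all
    polynomials.  It turns partial derivatives into one-variable derivatives
    along lines, which are insensitive to linear changes of coordinates. *)
Lemma heval_line F : exists p : {poly K},
  (forall t, p.[t] = heval F (v + t *: c)) /\ p^`().[0] = dirD F v c.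
Proof.
elim/mpolyind: F => [|a m F _ _ [q [hq dq]]].
  exists 0; split=> [t|]; first by rewrite horner0 /heval meval0.
  by rewrite deriv0 horner0 /dirD big1 // => i _; rewrite /partial mderiv0 /heval meval0 mulr0.
have [p [hp dp]] : exists p, restricts (mpolyX K m) p.
  rewrite mpolyXE_id; elim: (index_enum _) => [|i r [p hp]].
    by rewrite big_nil; have := restrictsXn ord0 0.
  rewrite big_cons; have [p1 hp1] := restrictsXn i (m i).
  by exists (p1 * p); apply: restrictsM.
exists (a *: p + q); split=> [t|].
  by rewrite hornerD hornerZ hp hq /heval mevalD mevalZ.
rewrite derivD derivZ hornerD hornerZ dp dq mulr_sumr -big_split.
by apply: eq_bigr => i _ /=; rewrite /partial mderivD mderivZ /heval mevalD mevalZ; ring.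
Qed.

Lemma dirD_deriv F (p : {poly K}) :
  (forall t, heval F (v + t *: c) = p.[t]) -> dirD F v c = p^`().[0].
Proof.
move=> h; have [q [hq <-]] := heval_line F; congr (_^`().[0]).
by apply: horner_inj => t; rewrite hq h.
Qed.
End Directional.

Lemma dirD_linear (K : comNzRingType) (F : mpoly 4 K) v (a : K) b c :
  dirD F v (a *: b + c) = a * dirD F v b + dirD F v c.
Proof.
rewrite /dirD mulr_sumr -big_split; apply: eq_bigr => i _ /=.
by rewrite !mxE; ring.
Qed.

Lemma heval_scale (K : comNzRingType) d (G : mpoly 4 K) k v : G \is ishomog1 d mdeg ->
  heval G (k *: v) = k ^+ d * heval G v.
Proof.
move=> /dhomogP hG; rewrite /heval !mevalE mulr_sumr big_seq [RHS]big_seq.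
apply: eq_bigr => m /hG /= <-; rewrite mdegE expr_sum mulrCA -big_split /=.
by congr (_ * _); apply: eq_bigr => i _; rewrite mxE exprMn.
Qed.

Lemma euler (K : numFieldType) d (G : mpoly 4 K) v : G \is ishomog1 d mdeg ->
  dirD G v v = d%:R * heval G v.
Proof.
move=> hG; rewrite (@dirD_deriv _ _ _ _ (heval G v *: (1 + 'X) ^+ d)) => [|t].
  rewrite derivZ deriv_exp derivD derivC derivX add0r mul1r.
  by rewrite !evalE addr0 expr1n mulrC.
by rewrite -[X in X + _]scale1r -scalerDl (heval_scale _ _ hG) !evalE mulrC.
Qed.

(** * Normal form of a quartic containing two skew lines *)
Definition vec4 (K : Type) (x y z w : K) : 'rV[K]_4 :=
  \row_i nth w [:: x; y; z; w] i.

Lemma vec4_eta (K : Type) (v : 'rV[K]_4) : exists x y z w, v = vec4 x y z w.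
Proof.
exists (v 0 0), (v 0 1), (v 0 2), (v 0 3).
by apply/rowP => -[[|[|[|[|i]]]] hi] //; rewrite mxE /=; congr (v _ _); exact: val_inj.
Qed.

(** The binary form of degree d that dehomogenizes to p at x = 1, when p has
    degree at most d. *)
Definition binform (K : nzRingType) d (p : {poly K}) (x y : K) : K :=
  \sum_(i < d.+1) p`_i * x ^+ (d - i) * y ^+ i.

Lemma binformD (K : comNzRingType) d (a : K) p q (x y : K) :
  binform d (a *: p + q) x y = a * binform d p x y + binform d q x y.
Proof.
rewrite /binform mulr_sumr -big_split; apply: eq_bigr => i _ /=.
by rewrite coefD coefZ; ring.
Qed.

Lemma binform0p (K : comNzRingType) d (x y : K) : binform d 0 x y = 0.
Proof. by rewrite /binform big1 // => i _; rewrite coef0 !mul0r. Qed.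

Lemma binformXn (K : comNzRingType) a b (x y : K) :
  binform (a + b) 'X^b x y = x ^+ a * y ^+ b.
Proof.
have hb : (b < (a + b).+1)%N by lia.
rewrite /binform (bigD1 (Ordinal hb)) //= big1 => [|i ib].
  by rewrite coefXn eqxx mul1r addnK addr0.
by rewrite coefXn -val_eqE /= in ib *; rewrite (negbTE ib) !mul0r.
Qed.

Lemma binform1 (K : comNzRingType) d (p : {poly K}) (x : K) :
  (size p <= d.+1)%N -> binform d p 1 x = p.[x].
Proof.
move=> h; rewrite (horner_coef_wide _ h) /binform.
by apply: eq_bigr => i _; rewrite expr1n mulr1.
Qed.

Lemma binform01 (K : comNzRingType) d (p : {poly K}) : binform d p 0 1 = p`_d.
Proof.
rewrite /binform big_ord_recr /= subnn expr0 expr1n !mulr1 big1 ?add0r // => i _.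
by rewrite expr0n subn_eq0 leqNgt ltn_ord /= mulr0 mul0r.
Qed.

Lemma binform_scale (K : comNzRingType) d (p : {poly K}) (a x y : K) :
  binform d p (a * x) (a * y) = a ^+ d * binform d p x y.
Proof.
rewrite /binform mulr_sumr; apply: eq_bigr => i _.
have -> : a ^+ d = a ^+ (d - i) * a ^+ i by rewrite -exprD subnK // -ltnS.
by rewrite !exprMn; ring.
Qed.

Lemma sum_pair_indic (K : comNzRingType) d (f : nat -> nat -> K) j0 k0 :
  (j0 + k0 <= d)%N ->
  (forall j k, (j, k) != (j0, k0) -> f j k = 0) ->
  \sum_(j < d.+1) \sum_(k < d.+1 - j) f j k = f j0 k0.
Proof.
move=> le f0; have hj : (j0 < d.+1)%N by lia.
have hk : (k0 < d.+1 - j0)%N by lia.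
rewrite (bigD1 (Ordinal hj)) //= [X in _ + X]big1 ?addr0 => [|j jj].
  rewrite (bigD1 (Ordinal hk)) //= big1 ?addr0 // => k kk.
  by apply: f0; rewrite xpair_eqE eqxx /=.
by apply: big1 => k _; apply: f0; rewrite xpair_eqE -val_eqE /= in jj *; rewrite (negbTE jj).
Qed.

(** Sorting the monomials x^a y^b z^j w^k by (j, k): those with given j and k
    make up a binary form of degree d - j - k in (x, y). *)
Lemma homog_normal_form (K : comNzRingType) d (F : mpoly 4 K) :
  F \is ishomog1 d mdeg ->
  exists C : nat -> nat -> {poly K},
    (forall j k, size (C j k) <= (d - j - k).+1)%N /\
    forall x y z w, heval F (vec4 x y z w) =
      \sum_(j < d.+1) \sum_(k < d.+1 - j)
         binform (d - j - k) (C j k) x y * z ^+ j * w ^+ k.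
Proof.
move=> /dhomogP hF; suff: exists C : nat -> nat -> {poly K},
    (forall j k, size (C j k) <= (d - j - k).+1)%N /\
    forall x y z w, \sum_(m <- msupp F) mcoeff m F * \prod_i (vec4 x y z w) 0 i ^+ (m i) =
      \sum_(j < d.+1) \sum_(k < d.+1 - j)
         binform (d - j - k) (C j k) x y * z ^+ j * w ^+ k.
  by move=> [C [sC hC]]; exists C; split=> // x y z w; rewrite -hC /heval mevalE.
elim: (msupp F : seq _) hF => [|m s IH] hs.
  exists (fun _ _ => 0); split=> [j k|x y z w]; first by rewrite size_poly0.
  by rewrite big_nil big1 // => j _; rewrite big1 // => k _; rewrite binform0p !mul0r.
have [m' m's|C [sC hC]] := IH; first by apply: hs; rewrite inE m's orbT.
have dm : (m 0%R + m 1%R + m 2%R + m 3%R = d)%N.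
  rewrite -(hs m (mem_head _ _)) /= mdegE !big_ord_recl big_ord0 addn0 !addnA.
  by congr (m _ + m _ + m _ + m _)%N; exact: val_inj.
pose M j k : {poly K} := if (j, k) == (m 2, m 3) then 'X^(m 1) else 0.
exists (fun j k => mcoeff m F *: M j k + C j k); split=> [j k|x y z w].
  rewrite (leq_trans (size_polyD _ _)) // geq_max sC andbT.
  rewrite (leq_trans (size_scale_leq _ _)) // /M; case: eqP => [[-> ->]|_].
    by rewrite size_polyXn; lia.
  by rewrite size_poly0.
rewrite big_cons hC; under [RHS]eq_bigr => j _ do (under eq_bigr => k _ do
  rewrite binformD 2!mulrDl; rewrite big_split /=); rewrite big_split /=; congr (_ + _).
rewrite (@sum_pair_indic _ d
  (fun j k => mcoeff m F * binform (d - j - k) (M j k) x y * z ^+ j * w ^+ k) (m 2) (m 3)).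
- rewrite /M eqxx; have -> : (d - m 2%R - m 3%R = m 0%R + m 1%R)%N by lia.
  rewrite binformXn !big_ord_recl big_ord0 !mxE /= mulr1 -!mulrA.
  by congr (_ * (_ ^+ m _ * (_ ^+ m _ * (_ ^+ m _ * _ ^+ m _)))); exact: val_inj.
- by lia.
- by move=> j k /negbTE jk; rewrite /M jk binform0p mulr0 !mul0r.
Qed.

Definition linform (K : comNzRingType) (P : 'M[K]_4) (i : 'I_4) : mpoly 4 K :=
  \sum_(j < 4) P j i *: mpolyX K (mnm1 j).

(** Homogeneity is a property of the polynomial and not of the function that it
    defines, so the new polynomial is built by substitution in the monomials. *)
Lemma homog_linear_change (K : comNzRingType) d (F : mpoly 4 K) (P : 'M[K]_4) :
  F \is ishomog1 d mdeg -> exists G : mpoly 4 K, G \is ishomog1 d mdeg /\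
    forall v, heval G v = heval F (v *m P).
Proof.
move=> /dhomogP hF.
have hl i : linform P i \is ishomog1 1 mdeg.
  by apply: rpred_sum => j _; apply: dhomogZ; rewrite dhomogX /= mdeg1.
exists (\sum_(m <- msupp F) mcoeff m F *: \prod_i linform P i ^+ m i); split.
  rewrite big_seq; apply: rpred_sum => m hm; apply: dhomogZ.
  rewrite -(hF m hm) /= mdegE.
  elim: (index_enum _) => [|i r IH]; first by rewrite !big_nil dhomog1.
  by rewrite !big_cons; apply: dhomogM => //; rewrite -[X in ishomog1 X]mul1n; apply: dhomogMn.
move=> v; rewrite /heval raddf_sum mevalE; apply: eq_bigr => m _ /=.
rewrite mevalZ rmorph_prod; congr (_ * _); apply: eq_bigr => i _.
rewrite rmorphXn /=; congr (_ ^+ _).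
rewrite raddf_sum mxE; apply: eq_bigr => j _ /=.
by rewrite mevalZ mevalXU mulrC.
Qed.

Lemma binformx0 (K : comNzRingType) d (p : {poly K}) (x : K) : binform d p x 0 = p`_0 * x ^+ d.
Proof.
rewrite /binform big_ord_recl subn0 expr0 mulr1 big1 ?addr0 // => i _.
by rewrite expr0n mulr0.
Qed.

Lemma binform0y (K : comNzRingType) d (p : {poly K}) (y : K) : binform d p 0 y = p`_d * y ^+ d.
Proof.
rewrite /binform big_ord_recr /= subnn expr0 mulr1 big1 ?add0r // => i _.
by rewrite expr0n subn_eq0 leqNgt ltn_ord /= mulr0 mul0r.
Qed.

Lemma binform_zero (K : comNzRingType) d (p : {poly K}) : binform d p 0 0 = p`_0 *+ (d == 0)%N.
Proof. by rewrite binformx0 expr0n; case: d => [|d]; rewrite ?mulr1 ?mulr0. Qed.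

Lemma binform_const (K : comNzRingType) (p : {poly K}) (x y : K) : binform 0 p x y = p`_0.
Proof. by rewrite /binform big_ord1 !mulr1. Qed.

(** The number ij in formij is the bidegree in (x, y) and (z, w). *)
Definition form31 (K : nzRingType) (A B : {poly K}) x y z w :=
  binform 3 A x y * z + binform 3 B x y * w.
Definition form22 (K : nzRingType) (E0 E1 E2 : {poly K}) x y z w :=
  binform 2 E0 x y * z ^+ 2 + binform 2 E1 x y * z * w + binform 2 E2 x y * w ^+ 2.
Definition form13 (K : nzRingType) (D0 D1 D2 D3 : {poly K}) x y z w :=
  binform 1 D0 x y * z ^+ 3 + binform 1 D1 x y * z ^+ 2 * w +
  binform 1 D2 x y * z * w ^+ 2 + binform 1 D3 x y * w ^+ 3.

(** F in the coordinates attached to the rows of P. *)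
Definition eval_in (K : comNzRingType) (F : mpoly 4 K) (P : 'M[K]_4) x y z w :=
  heval F (vec4 x y z w *m P).

Definition splits (K : comNzRingType) (f : K -> K -> K -> K -> K)
    (A B E0 E1 E2 D0 D1 D2 D3 : {poly K}) :=
  [/\ all (fun p : {poly K} => size p <= 4)%N [:: A; B],
      all (fun p : {poly K} => size p <= 3)%N [:: E0; E1; E2],
      all (fun p : {poly K} => size p <= 2)%N [:: D0; D1; D2; D3] &
      forall x y z w, f x y z w = form31 A B x y z w +
        form22 E0 E1 E2 x y z w + form13 D0 D1 D2 D3 x y z w].

(** Vanishing on the lines {z = w = 0} and {x = y = 0} kills the components of
    bidegree (4,0) and (0,4), which are the restrictions of F to these lines. *)
Lemma quartic_splits (K : comNzRingType) (F : mpoly 4 K) (P : 'M[K]_4) :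
  F \is ishomog1 4 mdeg ->
  (forall x y, eval_in F P x y 0 0 = 0) ->
  (forall z w, eval_in F P 0 0 z w = 0) ->
  exists A B E0 E1 E2 D0 D1 D2 D3,
    splits (eval_in F P) A B E0 E1 E2 D0 D1 D2 D3.
Proof.
move=> hF v1 v2.
have [G [hG GF]] := homog_linear_change P hF.
have {hG} [C [sC hC]] := homog_normal_form hG.
have {}hC x y z w : eval_in F P x y z w = _ := etrans (esym (GF _)) (hC x y z w).
exists (C 1%N 0%N), (C 0%N 1%N), (C 2%N 0%N), (C 1%N 1%N), (C 0%N 2%N),
  (C 3%N 0%N), (C 2%N 1%N), (C 1%N 2%N), (C 0%N 3%N).
have {}hC x y z w : eval_in F P x y z w =
    binform 4 (C 0%N 0%N) x y + (form31 (C 1%N 0%N) (C 0%N 1%N) x y z w +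
    form22 (C 2%N 0%N) (C 1%N 1%N) (C 0%N 2%N) x y z w +
    form13 (C 3%N 0%N) (C 2%N 1%N) (C 1%N 2%N) (C 0%N 3%N) x y z w) +
    (binform 0 (C 4%N 0%N) x y * z ^+ 4 + binform 0 (C 3%N 1%N) x y * z ^+ 3 * w +
     binform 0 (C 2%N 2%N) x y * z ^+ 2 * w ^+ 2 + binform 0 (C 1%N 3%N) x y * z * w ^+ 3 +
     binform 0 (C 0%N 4%N) x y * w ^+ 4).
  rewrite hC !big_ord_recl !big_ord0 /= /bump /= ?subn1 ?subn2 /form31 /form22 /form13.
  by rewrite -[X in _ = X]addr0; ring.
split; rewrite /= ?sC //.
move=> x y z w; rewrite hC.
have := hC x y 0 0; rewrite v1 /form31 /form22 /form13 !expr0n /= !mulr0 !addr0 => <-.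
have := hC 0 0 z w; rewrite v2 /form31 /form22 /form13 !binform_zero /=.
rewrite !mulr0n !mulr1n !mul0r !addr0 !add0r.
by rewrite !binform_const => <-; rewrite addr0.
Qed.

Lemma splits_odd (K : numDomainType) (f : K -> K -> K -> K -> K)
    A B E0 E1 E2 D0 D1 D2 D3 :
  splits f A B E0 E1 E2 D0 D1 D2 D3 ->
  (forall x y z w, f x y (- z) (- w) = - f x y z w) ->
  forall x y z w, f x y z w = form31 A B x y z w + form13 D0 D1 D2 D3 x y z w.
Proof.
move=> [_ _ _ hf] odd x y z w; have /eqP := odd x y z w; rewrite !hf.
rewrite -addr_eq0.
have -> : form31 A B x y (- z) (- w) + form22 E0 E1 E2 x y (- z) (- w) +
  form13 D0 D1 D2 D3 x y (- z) (- w) + (form31 A B x y z w + form22 E0 E1 E2 x y z w +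
  form13 D0 D1 D2 D3 x y z w) = form22 E0 E1 E2 x y z w *+ 2.
  by rewrite /form31 /form22 /form13; ring.
by rewrite mulrn_eq0 /= => /eqP ->; rewrite addr0.
Qed.

(** By Gauss, A divides E0, whose degree is too small; then A divides E1, and
    the relation is reduced to E2 A^2 = 0. *)
Lemma coprime_syzygy (K : fieldType) (A B E0 E1 E2 : {poly K}) :
  coprimep A B -> size A = 4 -> all (fun p : {poly K} => size p <= 3)%N [:: E0; E1; E2] ->
  E0 * B ^+ 2 - E1 * A * B + E2 * A ^+ 2 = 0 -> [/\ E0 = 0, E1 = 0 & E2 = 0].
Proof.
move=> cop sA /and4P[s0 s1 s2 _] h.
have A0 : A != 0 by rewrite -size_poly_eq0 sA.
have small (E : {poly K}) : (size E <= 3)%N -> A %| E -> E = 0.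
  move=> sE dE; apply/eqP; apply: contraTT isT => E0'.
  by have := leq_trans (dvdp_leq E0' dE) sE; rewrite sA.
have e0 : E0 = 0.
  apply: small => //; rewrite -(Gauss_dvdpl _ (coprimep_expr 2 cop)).
  have -> : E0 * B ^+ 2 = A * (E1 * B - E2 * A) by rewrite -[LHS]subr0 -h; ring.
  exact: dvdp_mulr.
have h1 : E1 * B = E2 * A.
  apply: (mulfI A0); apply/eqP; rewrite -subr_eq0 -oppr_eq0; apply/eqP.
  by rewrite -[RHS]h e0; ring.
have e1 : E1 = 0.
  by apply: small => //; rewrite -(Gauss_dvdpl _ cop) h1 dvdp_mulIr.
split=> //; apply/eqP; move/esym/eqP: h1.
by rewrite e1 mul0r mulf_eq0 (negbTE A0) orbF.
Qed.

(** * Consequences of smoothness *)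

Section Smooth.
Variables (K : numClosedFieldType) (F : mpoly 4 K) (P : 'M[K]_4).
Hypotheses (hF : smooth_quartic F) (hP : P \in unitmx).
Let f := eval_in F P.

(** The smoothness condition in the moving frame: vanishing in the directions of
    a basis forces all partial derivatives to vanish. *)
Lemma nonsingular v : v != 0 -> heval F v = 0 ->
  (forall i, dirD F v (row i P) = 0) -> False.
Proof.
move=> v0 Fv h; have [i /eqP] := hF.2 v v0 Fv; apply.
have dlin c : dirD F v (c *m P) = 0.
  rewrite mulmx_sum_row; elim: (index_enum _) => [|j r IH].
    by rewrite big_nil /dirD big1 // => j _; rewrite mxE mul0r.
  by rewrite big_cons dirD_linear h IH mulr0 addr0.
have := dlin (delta_mx 0 i *m invmx P); rewrite mulmxKV // /dirD (bigD1 i) //= big1.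
  by rewrite mxE !eqxx mul1r addr0.
by move=> j ji; rewrite mxE (negbTE ji) andbF mul0r.
Qed.

Lemma vec4_row x y z w : vec4 x y z w *m P =
  x *: row 0 P + y *: row 1 P + z *: row 2 P + w *: row 3 P.
Proof.
rewrite mulmx_sum_row !big_ord_recl big_ord0 addr0 !mxE /= !addrA.
by congr (_ + _ + _ + _); congr (_ *: row _ _); exact: val_inj.
Qed.

Lemma vec4_inj x y z w : vec4 x y z w *m P = 0 -> [/\ x = 0, y = 0, z = 0 & w = 0].
Proof.
move=> /(congr1 (mulmx^~ (invmx P))); rewrite mulmxK // mul0mx => /rowP h.
by split; [have := h 0 | have := h 1 | have := h 2 | have := h 3]; rewrite !mxE.
Qed.

Lemma vec4_shift x y z w t : let v := vec4 x y z w *m P in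
  [/\ v + t *: row 0 P = vec4 (x + t) y z w *m P,
      v + t *: row 1 P = vec4 x (y + t) z w *m P,
      v + t *: row 2 P = vec4 x y (z + t) w *m P &
      v + t *: row 3 P = vec4 x y z (w + t) *m P].
Proof. by split; rewrite !vec4_row; apply/rowP => j; rewrite !mxE; ring. Qed.

Lemma dirD_rows x y z w (px py pz pw : {poly K}) :
  (forall t, f (x + t) y z w = px.[t]) -> (forall t, f x (y + t) z w = py.[t]) ->
  (forall t, f x y (z + t) w = pz.[t]) -> (forall t, f x y z (w + t) = pw.[t]) ->
  let v := vec4 x y z w *m P in
  [/\ dirD F v (row 0 P) = px^`().[0], dirD F v (row 1 P) = py^`().[0],
      dirD F v (row 2 P) = pz^`().[0] & dirD F v (row 3 P) = pw^`().[0]].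
Proof.
move=> hx hy hz hw v; have sh := vec4_shift x y z w.
split; apply: dirD_deriv => t; have [s0 s1 s2 s3] := sh t.
- by rewrite s0 -hx.
- by rewrite s1 -hy.
- by rewrite s2 -hz.
- by rewrite s3 -hw.
Qed.

(** A form in which gradients are computed from the explicit shape of f only:
    px, py, pz, pw are its restrictions to lines parallel to the axes. *)
Lemma singular_criterion x y z w (px py pz pw : {poly K}) :
  f x y z w = 0 ->
  (forall t, f (x + t) y z w = px.[t]) -> (forall t, f x (y + t) z w = py.[t]) ->
  (forall t, f x y (z + t) w = pz.[t]) -> (forall t, f x y z (w + t) = pw.[t]) ->
  px^`().[0] = 0 -> py^`().[0] = 0 -> pz^`().[0] = 0 -> pw^`().[0] = 0 ->
  [/\ x = 0, y = 0, z = 0 & w = 0].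
Proof.
move=> f0 hx hy hz hw dx dy dz dw; apply: vec4_inj.
have [d0 d1 d2 d3] := dirD_rows hx hy hz hw.
apply/eqP; apply/negPn/negP => v0; apply: (nonsingular v0 f0) => i.
have : [|| i == 0, i == 1, i == 2 | i == 3] by case: i => -[|[|[|[|]]]].
by case/or4P => /eqP ->; rewrite ?d0 ?d1 ?d2 ?d3.
Qed.

(** In the chart x = 1 the derivative along x is a combination of the three others
    by Euler's identity. *)
Lemma singular_chart x z w (py pz pw : {poly K}) :
  f 1 x z w = 0 -> (forall t, f 1 (x + t) z w = py.[t]) ->
  (forall t, f 1 x (z + t) w = pz.[t]) -> (forall t, f 1 x z (w + t) = pw.[t]) ->
  py^`().[0] = 0 -> pz^`().[0] = 0 -> pw^`().[0] = 0 -> False.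
Proof.
move=> f0 hy hz hw dy dz dw; set v := vec4 1 x z w *m P.
have [px [hpx _]] := heval_line v (row 0 P) F.
have hx t : f (1 + t) x z w = px.[t].
  by rewrite hpx; have [-> _ _ _] := vec4_shift 1 x z w t.
have [d0 d1 d2 d3] := dirD_rows hx hy hz hw.
suff dx : px^`().[0] = 0.
  have [/eqP] := singular_criterion f0 hx hy hz hw dx dy dz dw.
  by rewrite oner_eq0.
rewrite -d0.
have -> : row 0 P = (- x) *: row 1 P + ((- z) *: row 2 P + ((- w) *: row 3 P + v)).
  by apply/rowP => i; rewrite /v vec4_row !mxE; ring.
by rewrite !dirD_linear d1 d2 d3 dy dz dw (euler _ hF.1) [heval F v]f0 !mulr0 !addr0.
Qed.

Variables (A B E0 E1 E2 D0 D1 D2 D3 : {poly K}).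
Hypothesis hf : splits f A B E0 E1 E2 D0 D1 D2 D3.

(** At a point of l1 only the terms of F linear in (z, w) have a differential:
    the gradient there is (0, 0, A, B). *)
Lemma smooth_on_line1 x y : binform 3 A x y = 0 -> binform 3 B x y = 0 -> x = 0 /\ y = 0.
Proof.
move=> a0 b0; have [_ _ _ hf'] := hf.
have l1 x' y' : f x' y' 0 0 = 0 by rewrite hf' /form31 /form22 /form13; ring.
suff [-> -> _ _] : [/\ x = 0, y = 0, 0 = 0 :> K & 0 = 0 :> K] by [].
apply: (@singular_criterion _ _ _ _ 0 0
  ((binform 2 E0 x y) *: 'X^2 + (binform 1 D0 x y) *: 'X^3)
  ((binform 2 E2 x y) *: 'X^2 + (binform 1 D3 x y) *: 'X^3)) => //.
- by move=> t; rewrite l1 horner0.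
- by move=> t; rewrite l1 horner0.
- by move=> t; rewrite hf' /form31 /form22 /form13 a0 b0 !evalE; ring.
- by move=> t; rewrite hf' /form31 /form22 /form13 a0 b0 !evalE; ring.
- by rewrite deriv0 horner0.
- by rewrite deriv0 horner0.
- by rewrite derivD !derivZ !derivXn !evalE; ring.
- by rewrite derivD !derivZ !derivXn !evalE; ring.
Qed.

(** The same along l2: the two hypotheses are the coefficients of x and y in
    form13, the part of F that is linear in (x, y). *)
Lemma smooth_on_line2 z w :
  D0`_0 * z ^+ 3 + D1`_0 * z ^+ 2 * w + D2`_0 * z * w ^+ 2 + D3`_0 * w ^+ 3 = 0 ->
  D0`_1 * z ^+ 3 + D1`_1 * z ^+ 2 * w + D2`_1 * z * w ^+ 2 + D3`_1 * w ^+ 3 = 0 ->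
  z = 0 /\ w = 0.
Proof.
move=> h0 h1; have [_ _ _ hf'] := hf.
have l2 z' w' : f 0 0 z' w' = 0.
  by rewrite hf' /form31 /form22 /form13 !binformx0; ring.
suff [_ _ -> ->] : [/\ 0 = 0 :> K, 0 = 0 :> K, z = 0 & w = 0] by [].
apply: (@singular_criterion _ _ _ _
  ((E0`_0 * z ^+ 2 + E1`_0 * z * w + E2`_0 * w ^+ 2) *: 'X^2 +
     (A`_0 * z + B`_0 * w) *: 'X^3)
  ((E0`_2 * z ^+ 2 + E1`_2 * z * w + E2`_2 * w ^+ 2) *: 'X^2 +
     (A`_3 * z + B`_3 * w) *: 'X^3) 0 0) => //.
- move=> t; rewrite add0r hf' /form31 /form22 /form13 !binformx0 !evalE.
  by apply: (@eq_of_multiple _ t _ _ _ h0); ring.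
- move=> t; rewrite add0r hf' /form31 /form22 /form13 !binform0y !evalE.
  by apply: (@eq_of_multiple _ t _ _ _ h1); ring.
- by move=> t; rewrite l2 horner0.
- by move=> t; rewrite l2 horner0.
- by rewrite derivD !derivZ !derivXn !evalE; ring.
- by rewrite derivD !derivZ !derivXn !evalE; ring.
- by rewrite deriv0 horner0.
- by rewrite deriv0 horner0.
Qed.

Lemma coprime_AB : coprimep A B.
Proof.
have [/and3P[sA sB _] _ _ _] := hf.
apply: Pdiv.ClosedField.root_coprimep => x /rootP a0; apply/rootP => b0.
have [] := @smooth_on_line1 1 x; rewrite ?binform1 // => /eqP.
by rewrite oner_eq0.
Qed.

(** The coefficients of degree 3 are the values of the two cubics at the point at
    infinity (0 : 1) of l1, where they do not both vanish. *)
Lemma lead_AB : size A = 4 \/ size B = 4.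
Proof.
have [/and3P[sA sB _] _ _ _] := hf.
have lead (p : {poly K}) : (size p <= 4)%N -> p`_3 != 0 -> size p = 4.
  move=> s p3; apply/eqP; rewrite eqn_leq s ltnNge; apply: contra p3 => s3.
  by rewrite nth_default.
have [a0|/(lead A sA)->] := eqVneq A`_3 0; last by left.
have [b0|/(lead B sB)->] := eqVneq B`_3 0; last by right.
have [] := @smooth_on_line1 0 1; rewrite ?binform01 // => _ /eqP.
by rewrite oner_eq0.
Qed.

(** The values of form22 at (1, x, -B, A) are those of a polynomial of degree at
    most 8, which has more than 8 roots; it vanishes, and coprime_syzygy applies
    to A or to B, one of which has degree 3. *)
Lemma form22_eq0_of_roots (s : seq K) : uniq s -> (8 < size s)%N ->
  (forall x, x \in s -> form22 E0 E1 E2 1 x (- B.[x]) A.[x] = 0) ->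
  [/\ E0 = 0, E1 = 0 & E2 = 0].
Proof.
have [/and3P[sA sB _] sE _ _] := hf; have /and4P[s0 s1 s2 _] := sE.
move=> us ss hs; pose H := E0 * B ^+ 2 - E1 * A * B + E2 * A ^+ 2.
have sM (p q : {poly K}) m n sp sq := (@coefM_top _ p q m n sp sq).1.
have sH : (size H <= 9)%N.
  have sD (p q : {poly K}) : (size p <= 9)%N -> (size q <= 9)%N -> (size (p + q)%R <= 9)%N.
    by move=> sp sq; rewrite (leq_trans (size_polyD _ _)) // geq_max sp.
  rewrite /H !expr2; apply: (sD); [apply: sD; rewrite ?size_polyN|].
  + exact: (sM _ _ 2%N 6%N s0 (sM _ _ 3%N 3%N sB sB)).
  + exact: (sM _ _ 5%N 3%N (sM _ _ 2%N 3%N s1 sA) sB).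
  + exact: (sM _ _ 2%N 6%N s2 (sM _ _ 3%N 3%N sA sA)).
have H0 : H = 0.
  apply: (@roots_geq_poly_eq0 _ _ s) => //; last exact: leq_trans sH ss.
  apply/allP => x xs; apply/rootP; rewrite /H -(hs x xs) /form22 !binform1 // !evalE; ring.
have [sA4|sB4] := lead_AB; first exact: (coprime_syzygy coprime_AB sA4 sE H0).
have sE' : all (fun p : {poly K} => size p <= 3)%N [:: E2; E1; E0] by rewrite /= s0 s1 s2.
have cBA : coprimep B A by rewrite coprimep_sym coprime_AB.
have [|e2 e1 e0] := coprime_syzygy cBA sB4 sE'; last by split.
by rewrite -[RHS]H0 /H; ring.
Qed.

(** On the line joining p in l1 to q in l2, f equals t (a + e t + d t^2) with
    a = form31, e = form22, d = form13.  If a and e were nonzero, this would have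
    a root t with t nonzero, and -t would be a root too, so that 2 e t^2 = 0.
    Hence form22 * form31 = 0; for fixed p this is a product of polynomials in q,
    and form31 is not the zero one, as A(p) and B(p) do not both vanish. *)
Lemma form22_eq0_of_invariant :
  (forall x y z w, f x y z w = 0 -> f x y (- z) (- w) = 0) ->
  [/\ E0 = 0, E1 = 0 & E2 = 0].
Proof.
have [/and3P[sA sB _] /and4P[s0 s1 s2 _] /and5P[d0 d1 d2 d3 _] hf'] := hf.
move=> inv.
have prod0 x z w : form22 E0 E1 E2 1 x z w = 0 \/ form31 A B 1 x z w = 0.
  set e := form22 _ _ _ _ _ _ _; set a := form31 _ _ _ _ _ _.
  have [|e0] := eqVneq e 0; first by left.
  have [|a0] := eqVneq a 0; first by right.
  set d := form13 D0 D1 D2 D3 1 x z w.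
  have [t] : exists t, root (a%:P + e *: 'X + d *: 'X^2) t.
    (* e != 0 makes the polynomial nonconstant *)
    apply/closed_rootP; apply/negP => /size_poly1P[c c0 /polyP /(_ 1%N)].
    rewrite !coefD !coefZ !coefC coefX coefXn /= mulr1 mulr0 add0r addr0 => /eqP.
    by rewrite (negbTE e0).
  rewrite rootE !evalE => /eqP rt.
  have fs s : f 1 x (s * z) (s * w) = s * (a + e * s + d * (s ^+ 2)).
    by rewrite hf' /a /e /d /form31 /form22 /form13; ring.
  have t0 : t != 0.
    by apply: contra a0 => /eqP t0; rewrite t0 in rt; rewrite -rt; apply/eqP; ring.
  have ft : f 1 x (t * z) (t * w) = 0 by rewrite fs rt mulr0.
  have := inv _ _ _ _ ft; rewrite -!mulNr fs => ft'.
  left; apply/eqP; have : e * t ^+ 2 *+ 2 = 0.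
    transitivity (t * (a + e * t + d * t ^+ 2) + - t * (a + e * - t + d * (- t) ^+ 2)).
      by ring.
    by rewrite rt ft'; ring.
  by move=> /eqP; rewrite mulrn_eq0 mulf_eq0 expf_eq0 (negbTE t0) /= orbF.
have coefs0 x : [/\ E0.[x] = 0, E1.[x] = 0 & E2.[x] = 0].
  pose p := (E0.[x])%:P + (E1.[x]) *: 'X + (E2.[x]) *: 'X^2.
  pose q := (A.[x])%:P + (B.[x]) *: 'X.
  have q0 : q != 0.
    apply/eqP => /polyP h; have := h 0%N; have := h 1%N.
    rewrite !coefD !coefZ !coefC !coefX /= !mulr0 !mulr1 add0r addr0 => b0 a0.
    have [] := @smooth_on_line1 1 x; rewrite ?binform1 // => /eqP.
    by rewrite oner_eq0.
  have : p * q = 0.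
    apply: horner_inj => t; rewrite hornerM horner0.
    have := prod0 x 1 t; rewrite /form22 /form31 !binform1 // => -[h|h].
      suff -> : p.[t] = 0 by rewrite mul0r.
      by rewrite -h /p !evalE; ring.
    suff -> : q.[t] = 0 by rewrite mulr0.
    by rewrite -h /q !evalE; ring.
  move/eqP; rewrite mulf_eq0 (negbTE q0) orbF => /eqP /polyP h.
  by split; [have := h 0%N | have := h 1%N | have := h 2%N];
    rewrite !coefD !coefZ !coefC !coefX !coefXn /= !mulr0 ?mulr1 ?add0r ?addr0.
by split; apply: horner_inj => x; rewrite horner0; have [] := coefs0 x.
Qed.

(** form13 at (1, x, -B, A): up to sign the resultant in (z : w) of form31 and
    form13, which is the form G of the introduction at x = 1. *)
Definition resultant_poly : {poly K} :=
  - (D0 * B ^+ 3) + D1 * B ^+ 2 * A - D2 * B * A ^+ 2 + D3 * A ^+ 3.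

Hypothesis odd : forall x y z w,
  f x y z w = form31 A B x y z w + form13 D0 D1 D2 D3 x y z w.

(** At a zero x of the resultant put (z, w) = (-B, A).  By Euler's identity the
    (z, w)-gradient (Dz, Dw) of form13 is proportional to that of form31, say
    (Dz, Dw) = delta (A, B).  Then the derivative of the resultant is
    beta - delta alpha, where alpha and beta are the derivatives along x of form31
    and form13.  If it vanishes, the gradient of F at (1, x, t z, t w) in the chart is
    (1 + delta t^2) times (t alpha, A, B), and one takes t^2 = - 1 / delta.  If
    delta = 0, then beta = 0 and the point (0, 0, z, w) of l2 is singular. *)
Lemma resultant_simple x :
  resultant_poly.[x] = 0 -> resultant_poly^`().[x] != 0.
Proof.
have [/and3P[sA sB _] _ /and5P[d0 d1 d2 d3 _] hf'] := hf.
move=> G0; apply/eqP => G'0.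
set a := A.[x] in G0 *; set b := B.[x] in G0 *.
set a' := A^`().[x] in G'0 *; set b' := B^`().[x] in G'0 *.
pose z := - b; pose w := a.
pose Dz := 3%:R * D0.[x] * z ^+ 2 + 2%:R * D1.[x] * z * w + D2.[x] * w ^+ 2.
pose Dw := D1.[x] * z ^+ 2 + 2%:R * D2.[x] * z * w + 3%:R * D3.[x] * w ^+ 2.
pose alpha := a' * z + b' * w.
pose beta := D0^`().[x] * z ^+ 3 + D1^`().[x] * z ^+ 2 * w +
  D2^`().[x] * z * w ^+ 2 + D3^`().[x] * w ^+ 3.
have D13 : D0.[x] * z ^+ 3 + D1.[x] * z ^+ 2 * w + D2.[x] * z * w ^+ 2 + D3.[x] * w ^+ 3 = 0.
  by rewrite -G0 /resultant_poly !evalE /z /w -/a -/b; ring.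
have ab : a = 0 -> b = 0 -> False.
  move=> a0 b0; have [] := @smooth_on_line1 1 x; rewrite ?binform1 // => /eqP.
  by rewrite oner_eq0.
have euler2 : a * Dw = b * Dz.
  apply: (@eq_of_multiple _ 3%:R _ _ _ D13); rewrite /Dz /Dw /z /w; ring.
have [delta [hz hw]] : exists delta, Dz = delta * a /\ Dw = delta * b.
  have [a0|a0] := eqVneq a 0.
    have b0 : b != 0 by apply/eqP => /(ab a0).
    exists (Dw / b); rewrite mulfVK // a0 mulr0; split=> //.
    by apply: (mulfI b0); rewrite -euler2 a0 mul0r mulr0.
  exists (Dz / a); rewrite mulfVK //; split=> //.
  by apply: (mulfI a0); rewrite euler2; field.
have dG : resultant_poly^`().[x] = beta + Dz * (- b') + Dw * a'.
  rewrite /resultant_poly !poly.derivE !evalE -/a -/b -/a' -/b'.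
  by rewrite /beta /Dz /Dw /z /w; ring.
have hbeta : beta = delta * alpha.
  apply: (@eq_of_multiple _ 1 _ _ _ G'0); rewrite dG hz hw /alpha /z /w; ring.
have [delta0|delta0] := eqVneq delta 0.
  rewrite delta0 mul0r in hbeta.
  (* the D_i have degree at most 1 *)
  have c1 (D : {poly K}) : (size D <= 2)%N -> D^`().[x] = D`_1 /\ D.[x] = D`_0 + D`_1 * x.
    move=> sD; rewrite (horner_coef_wide x sD) !big_ord_recl big_ord0 /=.
    rewrite expr0 expr1 mulr1 addr0; split=> //.
    have sD' : (size D^`() <= 1)%N.
      by apply: leq_trans (size_poly _ _) _; case: (size D) sD => [|[|[|]]].
    by rewrite (horner_coef_wide x sD') big_ord1 coef_deriv expr0 mulr1.
  have h1 : D0`_1 * z ^+ 3 + D1`_1 * z ^+ 2 * w + D2`_1 * z * w ^+ 2 + D3`_1 * w ^+ 3 = 0.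
    by move: hbeta; rewrite /beta (c1 _ d0).1 (c1 _ d1).1 (c1 _ d2).1 (c1 _ d3).1.
  have h0 : D0`_0 * z ^+ 3 + D1`_0 * z ^+ 2 * w + D2`_0 * z * w ^+ 2 + D3`_0 * w ^+ 3 = 0.
    transitivity ((D0.[x] * z ^+ 3 + D1.[x] * z ^+ 2 * w + D2.[x] * z * w ^+ 2 +
      D3.[x] * w ^+ 3) - x * (D0`_1 * z ^+ 3 + D1`_1 * z ^+ 2 * w + D2`_1 * z * w ^+ 2 +
      D3`_1 * w ^+ 3)).
      by rewrite (c1 _ d0).2 (c1 _ d1).2 (c1 _ d2).2 (c1 _ d3).2; ring.
    by rewrite D13 h1 mulr0 subr0.
  have [z0 w0] := smooth_on_line2 h0 h1.
  by apply: ab => //; apply/eqP; rewrite -oppr_eq0 -/z z0.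
pose t := sqrtC (- delta^-1).
have t2 : 1 + delta * t ^+ 2 = 0 by rewrite sqrtCK mulrN divff // subrr.
(* translation by x, so that derivatives are taken at 0 *)
pose sh (p : {poly K}) := p \Po ('X + x%:P).
have hsh p s : (sh p).[s] = p.[x + s] by rewrite /sh horner_comp !evalE addrC.
have dsh p : (sh p)^`().[0] = p^`().[x].
  by rewrite /sh deriv_comp derivD derivC derivX addr0 mulr1 horner_comp !evalE add0r.
apply: (@singular_chart x (t * z) (t * w)
  ((t * z) *: sh A + (t * w) *: sh B + ((t * z) ^+ 3 *: sh D0 + ((t * z) ^+ 2 * (t * w)) *: sh D1
   + ((t * z) * (t * w) ^+ 2) *: sh D2 + (t * w) ^+ 3 *: sh D3))
  (a *: ((t * z)%:P + 'X) + (b * (t * w))%:P +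
   (D0.[x] *: ((t * z)%:P + 'X) ^+ 3 + (D1.[x] * (t * w)) *: ((t * z)%:P + 'X) ^+ 2
   + (D2.[x] * (t * w) ^+ 2) *: ((t * z)%:P + 'X) + (D3.[x] * (t * w) ^+ 3)%:P))
  ((a * (t * z))%:P + b *: ((t * w)%:P + 'X) +
   ((D0.[x] * (t * z) ^+ 3)%:P + (D1.[x] * (t * z) ^+ 2) *: ((t * w)%:P + 'X)
   + (D2.[x] * (t * z)) *: ((t * w)%:P + 'X) ^+ 2 + D3.[x] *: ((t * w)%:P + 'X) ^+ 3))).
- rewrite odd /form31 /form13 !binform1 // -/a -/b.
  transitivity (t ^+ 3 * (D0.[x] * z ^+ 3 + D1.[x] * z ^+ 2 * w + D2.[x] * z * w ^+ 2 +
    D3.[x] * w ^+ 3)).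
    by rewrite /z /w; ring.
  by rewrite D13 mulr0.
- by move=> s; rewrite odd /form31 /form13 !binform1 // !(hornerD, hornerZ, hsh) /z /w; ring.
- by move=> s; rewrite odd /form31 /form13 !binform1 // !evalE /z /w /a /b; ring.
- by move=> s; rewrite odd /form31 /form13 !binform1 // !evalE /z /w /a /b; ring.
- rewrite !(derivD, derivZ, hornerD, hornerZ, dsh).
  transitivity (t * (alpha + t ^+ 2 * beta)); first by rewrite /alpha /beta /z /w /a' /b'; ring.
  by rewrite hbeta; apply: (@eq_of_multiple _ (t * alpha) _ _ _ t2); ring.
- rewrite !poly.derivE !evalE.
  transitivity (a + t ^+ 2 * Dz); first by rewrite /Dz /z /w; ring.
  by rewrite hz; apply: (@eq_of_multiple _ a _ _ _ t2); ring.
- rewrite !poly.derivE !evalE.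
  transitivity (b + t ^+ 2 * Dw); first by rewrite /Dw /z /w; ring.
  by rewrite hw; apply: (@eq_of_multiple _ b _ _ _ t2); ring.
Qed.

End Smooth.

(** * Points and lines as subspaces *)

Section Points.
Variable K : fieldType.

Lemma point_of_subproof (v : 'rV[K]_4) : v != 0 -> \dim <[v]>%VS == 1%N.
Proof. by move=> v0; rewrite dim_vline v0. Qed.

Definition point_of (v : 'rV[K]_4) (v0 : v != 0) : P3_point K :=
  exist _ <[v]>%VS (point_of_subproof v0).

Lemma vpick_point_neq0 (p : P3_point K) : vpick (val p) != 0.
Proof. by case: p => p /= /eqP dp; rewrite vpick0 -dimv_eq0 dp. Qed.

Lemma pointP (p : P3_point K) : exists2 v, v != 0 & v \in val p.
Proof. by exists (vpick (val p)); [exact: vpick_point_neq0|exact: memv_pick]. Qed.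

Lemma point_spanned (p : P3_point K) v : v != 0 -> v \in val p -> val p = <[v]>%VS.
Proof.
case: p => p /= /eqP dp v0 vp; apply/eqP; rewrite eq_sym eqEdim.
by rewrite -memvE vp dp dim_vline v0.
Qed.

Lemma point_eq (p q : P3_point K) v : v != 0 -> v \in val p -> v \in val q -> p = q.
Proof.
by move=> v0 vp vq; apply: val_inj; rewrite (point_spanned v0 vp) (point_spanned v0 vq).
Qed.

Lemma vlineZ (k : K) (v : 'rV[K]_4) : k != 0 -> <[k *: v]>%VS = <[v]>%VS.
Proof.
move=> k0; apply/eqP; rewrite eqEsubv -!memvE memvZ ?memv_line //=.
by rewrite -[X in X \in _](scalerK k0) memvZ // memv_line.
Qed.

Lemma lines_meetP (l m : P3_line K) : lines_meet l m <->
  exists v : 'rV[K]_4, [/\ v != 0, v \in val l & v \in val m].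
Proof.
split=> [[p [pl pm]]|[v [v0 vl vm]]].
  exists (vpick (val p)); split; first exact: vpick_point_neq0.
    by apply: (subvP pl); apply: memv_pick.
  by apply: (subvP pm); apply: memv_pick.
by exists (point_of v0); split; rewrite /line_points /= -memvE.
Qed.

(** The zero vector spans no point, but it belongs to all of them; so it is
    enough that the line has one point. *)
Lemma line_in_surfaceP (F : mpoly 4 K) (l : P3_line K) :
  (line_points l `<=` surface F) <-> (forall v, v \in val l -> heval F v = 0).
Proof.
split=> [h v vl|h p pl v vp]; last by apply: h; apply: (subvP pl).
have [v0|v0] := eqVneq v 0; last first.
  by apply: (h (point_of v0)); rewrite /line_points /= -?memvE // memv_line.
have u0 : vpick (val l) != 0.
  by case: l {h vl} => l /= /eqP dl; rewrite vpick0 -dimv_eq0 dl.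
apply: (h (point_of u0)); first by rewrite /line_points /= -memvE memv_pick.
by rewrite v0 mem0v.
Qed.

Lemma mem_join (p q v : 'rV[K]_4) :
  reflect (exists s t, v = s *: p + t *: q) (v \in <[p]> + <[q]>)%VS.
Proof.
apply: (iffP memv_addP) => [[_ /vlineP[s ->] [_ /vlineP[t ->] ->]]|[s [t ->]]].
  by exists s, t.
exists (s *: p); first by rewrite memvZ // memv_line.
by exists (t *: q); rewrite ?memvZ ?memv_line.
Qed.

Lemma line_basis (l : P3_line K) : exists u v : 'rV[K]_4,
  val l = (<[u]> + <[v]>)%VS /\ forall a b, a *: u + b *: v = 0 -> a = 0 /\ b = 0.
Proof.
case: l => l /= /eqP dl.
have := vbasisP l; have : size (vbasis l) = 2 := etrans (size_tuple _) dl.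
case: (tval (vbasis l)) => [|u [|v [|]]] // _ /andP[/eqP <- fr].
exists u, v; split; first by rewrite span_cons span_seq1.
move: fr; rewrite free_cons span_seq1 seq1_free => /andP[uv v0] a b ab.
have a0 : a = 0.
  apply: contraNeq uv => a0; apply/vlineP; exists (- (b / a)).
  apply: (scalerI a0); rewrite scalerA mulrN mulrC mulfVK // scaleNr.
  by apply/eqP; rewrite -addr_eq0 ab.
split=> //; apply/eqP; move/eqP: ab; rewrite a0 scale0r add0r scaler_eq0.
by rewrite (negbTE v0) orbF.
Qed.

Lemma line_eq_join (m : P3_line K) (p q : 'rV[K]_4) :
  p \in val m -> q \in val m -> p != 0 -> q \notin <[p]>%VS ->
  val m = (<[p]> + <[q]>)%VS.
Proof.
case: m => m /= /eqP dm pm qm p0 qp; apply/esym/eqP.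
rewrite eqEdim subv_add -!memvE pm qm dm /= dimv_disjoint_sum.
  rewrite !dim_vline p0; case: (eqVneq q 0) qp => [->|//]; by rewrite mem0v.
apply/eqP; rewrite -subv0; apply/subvP => v /memv_capP[/vlineP[s ->] /vlineP[t st]].
rewrite memv0 st; have [->|t0] := eqVneq t 0; first by rewrite scale0r.
case/negP: qp; apply/vlineP; exists (t^-1 * s).
by rewrite -scalerA st scalerA mulVf // scale1r.
Qed.
End Points.

Definition rows4 (K : Type) (a b c d : 'rV[K]_4) : 'M[K]_4 :=
  \matrix_(i, j) (nth d [:: a; b; c; d] i) 0 j.

Lemma mul_rows4 (K : fieldType) (a b c d : 'rV[K]_4) x y z w :
  vec4 x y z w *m rows4 a b c d = x *: a + y *: b + z *: c + w *: d.
Proof.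
by apply/rowP => j; rewrite !mxE !big_ord_recl big_ord0 !mxE /=; ring.
Qed.

Lemma rows4_unit (K : fieldType) (a b c d : 'rV[K]_4) :
  (forall x y z w, x *: a + y *: b + z *: c + w *: d = 0 ->
    [/\ x = 0, y = 0, z = 0 & w = 0]) -> rows4 a b c d \in unitmx.
Proof.
move=> h; rewrite -row_free_unit; apply: inj_row_free => v.
have [x [y [z [w ->]]]] := vec4_eta v.
rewrite mul_rows4 => /h[-> -> -> ->].
by apply/rowP => i; rewrite !mxE; case: i => -[|[|[|[|]]]].
Qed.

(** The first two rows of P span l1 and the last two span l2. *)
Definition frame (K : fieldType) (l1 l2 : {vspace 'rV[K]_4}) (P : 'M[K]_4) :=
  [/\ P \in unitmx,
      forall x y z w, (vec4 x y z w *m P \in l1) = (z == 0) && (w == 0) &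
      forall x y z w, (vec4 x y z w *m P \in l2) = (x == 0) && (y == 0)].

Section Frames.
Variables (K : fieldType).

Lemma frame_exists (l1 l2 : P3_line K) : ~ lines_meet l1 l2 ->
  exists P, frame (val l1) (val l2) P.
Proof.
move=> dis; have [a [b [e1 f1]]] := line_basis l1.
have [c [d [e2 f2]]] := line_basis l2.
have cap v : v \in val l1 -> v \in val l2 -> v = 0.
  move=> v1 v2; apply: contrapT => /eqP v0; apply: dis; apply/lines_meetP.
  by exists v.
have m1 x y : x *: a + y *: b \in val l1 by rewrite e1; apply/mem_join; exists x, y.
have m2 z w : z *: c + w *: d \in val l2 by rewrite e2; apply/mem_join; exists z, w.
exists (rows4 a b c d); split=> [|x y z w|x y z w].
- apply: rows4_unit => x y z w; rewrite -addrA => /eqP; rewrite addr_eq0 => /eqP h.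
  have h1 : x *: a + y *: b = 0 by apply: cap => //; rewrite h memvN.
  have [-> ->] := f1 _ _ h1; move: h; rewrite h1 => /esym/eqP.
  by rewrite oppr_eq0 => /eqP /f2[-> ->].
- rewrite mul_rows4 -addrA rpredDl ?m1 //; apply/idP/andP => [h|[/eqP-> /eqP->]].
    by have [-> ->] := f2 _ _ (cap _ h (m2 z w)).
  by rewrite !scale0r addr0 mem0v.
- rewrite mul_rows4 -addrA addrC rpredDl ?m2 //; apply/idP/andP => [h|[/eqP-> /eqP->]].
    by have [-> ->] := f1 _ _ (cap _ (m1 x y) h).
  by rewrite !scale0r addr0 mem0v.
Qed.

(** Changes the basis (e0, e1) of l1 into (e1, e0 + c e1), which puts the point of
    parameter c at infinity. *)
Lemma frame_shear (l1 l2 : {vspace 'rV[K]_4}) P (c : K) : frame l1 l2 P ->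
  exists P', frame l1 l2 P' /\
    forall x y z w, vec4 x y z w *m P' = vec4 y (x + c * y) z w *m P.
Proof.
move=> [uP h1 h2].
pose P' := rows4 (vec4 0 1 0 0 *m P) (vec4 1 c 0 0 *m P) (vec4 0 0 1 0 *m P) (vec4 0 0 0 1 *m P).
have hP' x y z w : vec4 x y z w *m P' = vec4 y (x + c * y) z w *m P.
  rewrite mul_rows4 !scalemxAl -!mulmxDl; congr (_ *m _).
  by apply/rowP => i; rewrite !mxE; case: i => -[|[|[|[|]]]] //= _; ring.
exists P'; split=> //; split=> [|x y z w|x y z w].
- apply: rows4_unit => x y z w; rewrite -mul_rows4 -/P' hP'.
  move=> /(congr1 (mulmx^~ (invmx P))); rewrite mulmxK // mul0mx => /rowP h.
  have := h 0; have := h 1; have := h 2; have := h 3; rewrite !mxE /= => -> -> e ->.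
  by move: e; move: (h 0); rewrite !mxE /= => ->; rewrite mulr0 addr0.
- by rewrite hP' h1.
- rewrite hP' h2; have [->|//] := eqVneq y 0; last by rewrite andbF.
  by rewrite mulr0 addr0 andbT.
Qed.
End Frames.

(** * Lines meeting both given lines *)

Section Lines.
Variables (K : numClosedFieldType) (F : mpoly 4 K) (l1 l2 : P3_line K) (P : 'M[K]_4).
Hypotheses (hF : smooth_quartic F) (hP : frame (val l1) (val l2) P).
Let f := eval_in F P.
Let phi x y z w := vec4 x y z w *m P.

Lemma frame_unit : P \in unitmx. Proof. by case: hP. Qed.

Lemma frame_coord v : exists x y z w, v = phi x y z w.
Proof.
have [x [y [z [w e]]]] := vec4_eta (v *m invmx P).
by exists x, y, z, w; rewrite /phi -e mulmxKV // frame_unit.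
Qed.

Lemma frame_coord1 v : v \in val l1 -> exists x y, v = phi x y 0 0.
Proof.
have [x [y [z [w ->]]]] := frame_coord v; rewrite /phi; case: hP => _ -> _ /andP[/eqP-> /eqP->].
by exists x, y.
Qed.

Lemma frame_coord2 v : v \in val l2 -> exists z w, v = phi 0 0 z w.
Proof.
have [x [y [z [w ->]]]] := frame_coord v; rewrite /phi; case: hP => _ _ -> /andP[/eqP-> /eqP->].
by exists z, w.
Qed.

Lemma phi_lin s t x y z w x' y' z' w' :
  s *: phi x y z w + t *: phi x' y' z' w' =
  phi (s * x + t * x') (s * y + t * y') (s * z + t * z') (s * w + t * w').
Proof.
rewrite /phi !scalemxAl -mulmxDl; congr (_ *m _).
by apply/rowP => i; rewrite !mxE; case: i => -[|[|[|[|]]]].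
Qed.

Lemma phiZ k x y z w : k *: phi x y z w = phi (k * x) (k * y) (k * z) (k * w).
Proof. by rewrite -[LHS]addr0 -(scale0r (phi 0 0 0 0)) phi_lin; congr phi; ring. Qed.

Lemma phi_inj x y z w x' y' z' w' : phi x y z w = phi x' y' z' w' ->
  [/\ x = x', y = y', z = z' & w = w'].
Proof.
move=> /(congr1 (mulmx^~ (invmx P))); rewrite !mulmxK ?frame_unit // => /rowP h.
by split; [have := h 0 | have := h 1 | have := h 2 | have := h 3]; rewrite !mxE.
Qed.

Lemma phi0 : phi 0 0 0 0 = 0.
Proof.
rewrite -[RHS](mul0mx _ P); congr (_ *m _); apply/rowP => i.
by rewrite !mxE; case: i => -[|[|[|[|]]]].
Qed.

Variables (A B E0 E1 E2 D0 D1 D2 D3 : {poly K}).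
Hypothesis hf : splits f A B E0 E1 E2 D0 D1 D2 D3.

(** The line through the point (x : y) of l1 and the point of l2 at which form31
    vanishes. *)
Definition transversal x y : {vspace 'rV[K]_4} :=
  (<[phi x y 0 0]> + <[phi 0 0 (- binform 3 B x y) (binform 3 A x y)]>)%VS.

Lemma transversalZ k x y : k != 0 -> transversal (k * x) (k * y) = transversal x y.
Proof.
move=> k0; rewrite /transversal !binform_scale.
have -> : phi (k * x) (k * y) 0 0 = k *: phi x y 0 0.
  by rewrite phiZ; congr phi; ring.
have -> : phi 0 0 (- (k ^+ 3 * binform 3 B x y)) (k ^+ 3 * binform 3 A x y) =
   k ^+ 3 *: phi 0 0 (- binform 3 B x y) (binform 3 A x y).
  by rewrite phiZ; congr phi; ring.
by rewrite !vlineZ // expf_neq0.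
Qed.

Lemma AB_neq0 x y : (x, y) != (0, 0) ->
  (- binform 3 B x y, binform 3 A x y) != (0, 0).
Proof.
apply: contra => /eqP[/eqP]; rewrite oppr_eq0 => /eqP b0 a0.
by have [-> ->] := smooth_on_line1 hF frame_unit hf a0 b0.
Qed.

(** (A, B) is not zero, so the solutions (z, w) of A z + B w = 0 are the multiples
    of (-B, A). *)
Lemma transversal_eq (m : P3_line K) x y z w : (x, y) != (0, 0) -> (z, w) != (0, 0) ->
  phi x y 0 0 \in val m -> phi 0 0 z w \in val m ->
  form31 A B x y z w = 0 -> val m = transversal x y.
Proof.
move=> xy zw pm qm h31.
have p0 : phi x y 0 0 != 0.
  by rewrite -phi0; apply: contra xy => /eqP /phi_inj[-> ->].
rewrite (line_eq_join pm qm p0); last first.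
  by apply: contra zw => /vlineP[s]; rewrite phiZ mulr0 => /phi_inj[_ _ -> ->].
rewrite /transversal; congr (_ + _)%VS.
have := AB_neq0 xy; set a := binform 3 A x y; set b := binform 3 B x y => ab.
have {}h31 : a * z + b * w = 0 by [].
have [c [hz hw]] : exists c, z = c * (- b) /\ w = c * a.
  have [a0|a0] := eqVneq a 0.
    have b0 : b != 0 by apply: contra ab => /eqP ->; rewrite a0 oppr0.
    exists (- (z / b)); rewrite mulrNN mulfVK // a0 mulr0; split=> //.
    by apply: (mulfI b0); rewrite mulr0 -h31 a0 mul0r add0r.
  exists (w / a); rewrite mulfVK //; split=> //; apply: (mulfI a0).
  by apply/eqP; rewrite -subr_eq0 -h31; apply/eqP; field.
have c0 : c != 0 by apply: contra zw => /eqP c0; rewrite hz hw c0 !mul0r.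
rewrite -[RHS](vlineZ _ c0); congr (<[_]>)%VS.
by rewrite phiZ hz hw; congr phi; ring.
Qed.

(** Along the line, f is a polynomial in t whose coefficients are the values of the
    three forms. *)
Lemma forms_vanish (m : P3_line K) x y z w : (forall v, v \in val m -> heval F v = 0) ->
  phi x y 0 0 \in val m -> phi 0 0 z w \in val m ->
  form31 A B x y z w = 0 /\ form22 E0 E1 E2 x y z w = 0.
Proof.
move=> Fm pm qm; have [_ _ _ hf'] := hf.
pose p := form31 A B x y z w *: 'X + form22 E0 E1 E2 x y z w *: 'X^2 +
  form13 D0 D1 D2 D3 x y z w *: 'X^3.
have /polyP p0 : p = 0.
  apply: horner_inj => t; rewrite horner0 /p !evalE.
  have : f x y (t * z) (t * w) = 0.
    apply: Fm; have -> : vec4 x y (t * z) (t * w) *m P = 1 *: phi x y 0 0 + t *: phi 0 0 z w.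
      by rewrite phi_lin /phi; congr (vec4 _ _ _ _ *m _); ring.
    by apply: memvD; apply: memvZ.
  by rewrite hf' => <-; rewrite /form31 /form22 /form13; ring.
by split; [have := p0 1%N | have := p0 2%N]; rewrite /p !coefD !coefZ coefX !coefXn coef0 /=
   ?mulr0 ?mulr1 ?add0r ?addr0.
Qed.

Lemma meeting_line (m : P3_line K) : (forall v, v \in val m -> heval F v = 0) ->
  lines_meet m l1 -> lines_meet m l2 ->
  exists x y, [/\ (x, y) != (0, 0), val m = transversal x y &
    form22 E0 E1 E2 x y (- binform 3 B x y) (binform 3 A x y) = 0].
Proof.
move=> Fm /lines_meetP[u [u0 um /frame_coord1[x [y eu]]]].
move=> /lines_meetP[v [v0 vm /frame_coord2[z [w ev]]]].
rewrite {u}eu in u0 um; rewrite {v}ev in v0 vm.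
have xy : (x, y) != (0, 0) by apply: contra u0 => /eqP[-> ->]; rewrite phi0.
have zw : (z, w) != (0, 0) by apply: contra v0 => /eqP[-> ->]; rewrite phi0.
have [h31 _] := forms_vanish Fm um vm.
have mt := transversal_eq xy zw um vm h31.
exists x, y; split=> //.
apply: (forms_vanish Fm um _).2; rewrite mt /transversal.
by apply/mem_join; exists 0, 1; rewrite scale0r add0r scale1r.
Qed.

(** Distinct lines have distinct parameters (x : y), at most one of which is at
    infinity; the others provide nine roots for form22_eq0_of_roots. *)
Lemma twin_form22_eq0 : twin_lines (surface F) l1 l2 -> [/\ E0 = 0, E1 = 0 & E2 = 0].
Proof.
move=> [_ _ _ [s [us hs]]].
pose s' := [seq m <- s | val m != transversal 0 1].
have key (m : P3_line K) : exists x, m \in s' -> val m = transversal 1 x /\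
    form22 E0 E1 E2 1 x (- B.[x]) A.[x] = 0.
  have [ms'|_] := boolP (m \in s'); last by exists 0.
  move: (ms'); rewrite mem_filter => /andP[mt /hs[_ _ /line_in_surfaceP Fm m1 m2]].
  have [x [y [xy e h22]]] := meeting_line Fm m1 m2.
  have [/and3P[sA sB _] /and4P[s0 s1 s2 _] _ _] := hf.
  have [x0|x0] := eqVneq x 0.
    have y0 : y != 0 by apply: contra xy => /eqP ->; rewrite x0.
    by case/negP: mt; rewrite e x0 -(transversalZ 0 1 y0) mulr0 mulr1.
  exists (y / x) => _; have ex : x * (y / x) = y by field.
  split; first by rewrite e -(transversalZ 1 (y / x) x0) mulr1 ex.
  have hx d (p : {poly K}) : (size p <= d.+1)%N -> binform d p x y = x ^+ d * p.[y / x].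
    by move=> sp; rewrite -{1}ex -{1}(mulr1 x) binform_scale binform1.
  move: h22; rewrite /form22 !hx ?binform1 // => h22.
  (* form22 has degree 2, and (-B, A) degree 3: total degree 2 + 2 * 3 = 8 *)
  by apply: (mulfI (expf_neq0 8 x0)); rewrite mulr0 -h22; ring.
have [X hX] := boolp.choice key.
apply: (@form22_eq0_of_roots _ F P hF frame_unit _ _ _ _ _ _ _ _ _ hf [seq X m | m <- s']).
- rewrite map_inj_in_uniq ?filter_uniq // => m m' /hX[e _] /hX[e' _] exx.
  by apply: val_inj; rewrite /= e e' exx.
- rewrite size_map size_filter; set p := fun m : P3_line K => _.
  have h10 : (count p s + count (predC p) s = 10)%N := etrans (count_predC p s) (size_tuple s).
  have : (count (predC p) s <= 1)%N.
    rewrite (eq_count (a2 := preim val (pred1 (transversal 0 1)))).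
      by rewrite -count_map count_uniq_mem ?leq_b1 // map_inj_uniq //; apply: val_inj.
    by move=> m /=; rewrite negbK.
  by move: h10; set c := count p s; set c' := count _ s; lia.
- by move=> x /mapP[m ms ->]; have [] := hX m ms.
Qed.

Hypothesis odd : forall x y z w,
  f x y z w = form31 A B x y z w + form13 D0 D1 D2 D3 x y z w.
Hypothesis hl1 : line_points l1 `<=` surface F.
Hypothesis hl2 : line_points l2 `<=` surface F.

Let G := resultant_poly A B D0 D1 D2 D3.

Lemma resultantE x :
  form13 D0 D1 D2 D3 1 x (- binform 3 B 1 x) (binform 3 A 1 x) = G.[x].
Proof.
have [/and3P[sA sB _] _ /and5P[d0 d1 d2 d3 _] _] := hf.
by rewrite /form13 !binform1 // /G /resultant_poly !evalE; ring.
Qed.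

Lemma transversal_in_surface x y (v : 'rV[K]_4) :
  form13 D0 D1 D2 D3 x y (- binform 3 B x y) (binform 3 A x y) = 0 ->
  v \in transversal x y -> heval F v = 0.
Proof.
set b := binform 3 B x y; set a := binform 3 A x y => G0.
move=> /mem_join[s [t ->]]; rewrite phi_lin [heval _ _]odd.
have -> : form31 A B (s * x + t * 0) (s * y + t * 0) (s * 0 + t * - b) (s * 0 + t * a) = 0.
  by rewrite !mulr0 !addr0 !add0r /form31 !binform_scale /a /b; ring.
rewrite add0r; apply: (@eq_of_multiple _ (s * t ^+ 3) _ _ _ G0).
by rewrite !mulr0 !addr0 !add0r /form13 !binform_scale /a /b; ring.
Qed.

Lemma dim_transversal x y : (x, y) != (0, 0) -> \dim (transversal x y) == 2%N.
Proof.
move=> xy; have zw := AB_neq0 xy.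
rewrite /transversal dimv_disjoint_sum ?dim_vline.
  set p := phi _ _ _ _; set q := phi _ _ _ _.
  have -> : p != 0 by rewrite -phi0; apply: contra xy => /eqP/phi_inj[-> -> _ _].
  have -> // : q != 0 by rewrite -phi0; apply: contra zw => /eqP/phi_inj[_ _ -> ->].
apply/eqP; rewrite -subv0; apply/subvP => v /memv_capP[/vlineP[s ->] /vlineP[t]].
rewrite !phiZ => /phi_inj; rewrite !mulr0 => -[-> -> _ _].
by rewrite phi0 mem0v.
Qed.

Lemma affine_neq0 x : (1, x) != (0, 0) :> K * K.
Proof. by rewrite xpair_eqE oner_eq0. Qed.

Definition transversal_line x : P3_line K :=
  exist _ (transversal 1 x) (dim_transversal (affine_neq0 x)).

Lemma transversal_mem1 x y : (phi 1 y 0 0 \in transversal 1 x) = (y == x).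
Proof.
apply/mem_join/eqP => [[s [t]]|->]; last by exists 1, 0; rewrite scale0r addr0 scale1r.
by rewrite phi_lin => /phi_inj[]; rewrite !mulr0 !addr0 mulr1 => <-; rewrite mul1r.
Qed.

(** The roots of the resultant are simple, so there are as many as its degree, and
    each of them is the parameter of a transversal on the surface. *)
Lemma twin_of_odd : ~ lines_meet l1 l2 -> size G = 11%N -> twin_lines (surface F) l1 l2.
Proof.
move=> dis sG; split=> //.
have [rs eG] := closed_field_poly_normal G.
have G0 : G != 0 by rewrite -size_poly_eq0 sG.
have lG0 : lead_coef G != 0 by rewrite lead_coef_eq0.
have szrs : size rs == 10%N.
  by move: sG; rewrite eG size_scale // size_prod_XsubC => -[->].
have rsG x : x \in rs -> root G x by rewrite eG rootZ // root_prod_XsubC.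
have urs : uniq rs.
  rewrite -separable_prod_XsubC unlock.
  apply: Pdiv.ClosedField.root_coprimep => x xr.
  have rG : root G x by rewrite eG rootZ.
  have := resultant_simple hF frame_unit hf odd (rootP rG); rewrite -/G.
  by apply: contra; rewrite [in X in _ -> X]eG derivZ hornerZ => /rootP ->; rewrite mulr0.
have [_ h1 h2] := hP.
pose s := map_tuple transversal_line (Tuple szrs).
exists s; split.
  rewrite map_inj_uniq // => x x' /(congr1 val) /= e.
  by apply/eqP; rewrite -transversal_mem1 -e transversal_mem1.
move=> m /mapP[x /rsG /rootP xG ->]; rewrite -resultantE in xG.
have p1 : phi 1 x 0 0 \in val l1 by rewrite h1 !eqxx.
have pm : phi 1 x 0 0 \in transversal 1 x by rewrite transversal_mem1.
have p0 : phi 1 x 0 0 != 0.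
  by rewrite -phi0; apply/eqP => /phi_inj[/eqP]; rewrite oner_eq0.
have zw : (- binform 3 B 1 x, binform 3 A 1 x) != (0, 0).
  exact: AB_neq0 (affine_neq0 x).
set q := phi 0 0 (- binform 3 B 1 x) (binform 3 A 1 x).
have q2 : q \in val l2 by rewrite h2 !eqxx.
have qm : q \in transversal 1 x.
  by apply/mem_join; exists 0, 1; rewrite scale0r add0r scale1r.
have q0 : q != 0 by rewrite -phi0; apply: contra zw => /eqP/phi_inj[_ _ -> ->].
split.
- apply: contra zw => /eqP e; move: qm.
  by rewrite -[transversal 1 x]/(val (transversal_line x)) e h1.
- apply/eqP => e; move: pm; rewrite -[transversal 1 x]/(val (transversal_line x)) e h2.
  by rewrite oner_eq0.
- by apply/line_in_surfaceP => v; apply: transversal_in_surface xG.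
- by apply/lines_meetP; exists (phi 1 x 0 0).
- by apply/lines_meetP; exists q.
Qed.

(** A characterization of the roots that does not refer to the coordinates of l1,
    for comparing the resultants of two frames. *)
Lemma resultant_root_of_line (m : P3_line K) x :
  (forall v, v \in val m -> heval F v = 0) -> phi 1 x 0 0 \in val m ->
  lines_meet m l2 -> G.[x] = 0.
Proof.
move=> Fm pm /lines_meetP[v [v0 vm /frame_coord2[z [w ev]]]]; rewrite {v}ev in v0 vm.
have zw : (z, w) != (0, 0) by apply: contra v0 => /eqP[-> ->]; rewrite phi0.
have [h31 _] := forms_vanish Fm pm vm.
have em := transversal_eq (affine_neq0 x) zw pm vm h31.
rewrite -resultantE; set b := binform 3 B 1 x; set a := binform 3 A 1 x.
have : f 1 x (- b) a = 0.
  apply: Fm; rewrite em; apply/mem_join; exists 1, 1.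
  by rewrite phi_lin /phi /a /b; congr (vec4 _ _ _ _ *m _); ring.
rewrite odd => <-; rewrite [X in _ = X + _](_ : _ = 0) ?add0r //.
by rewrite /form31 /a /b; ring.
Qed.

(** The zero polynomial has multiple roots. *)
Lemma resultant_neq0 : G != 0.
Proof.
apply/eqP => G0; have := @resultant_simple _ F P hF frame_unit _ _ _ _ _ _ _ _ _ hf odd 0.
by rewrite -/G G0 horner0 deriv0 horner0 eqxx => /(_ erefl).
Qed.

(** The resultant is the dehomogenization of a binary form of degree 1 + 3 * 3,
    whose value at (0 : 1) is the coefficient of degree 10. *)
Lemma resultant_lead :
  (size G <= 11)%N /\ G`_10 = form13 D0 D1 D2 D3 0 1 (- binform 3 B 0 1) (binform 3 A 0 1).
Proof.
have [/and3P[sA sB _] _ /and5P[d0 d1 d2 d3 _] _] := hf.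
pose top n (p : {poly K}) (c : K) := (size p <= n.+1)%N /\ p`_n = c.
have topM m n p q c d : top m p c -> top n q d -> top (m + n)%N (p * q) (c * d).
  move=> [sp <-] [sq <-]; exact: (coefM_top sp sq).
have topD n p q c d : top n p c -> top n q d -> top n (p + q) (c + d).
  move=> [sp <-] [sq <-]; split; last by rewrite coefD.
  by rewrite (leq_trans (size_polyD _ _)) // geq_max sp.
have topN n p c : top n p c -> top n (- p) (- c).
  by move=> [sp <-]; rewrite /top size_polyN coefN.
have topX n p k c : top n p c -> top (n * k)%N (p ^+ k) (c ^+ k).
  move=> tp; elim: k => [|k IH]; last by rewrite mulnS !exprS; apply: topM.
  by rewrite muln0 !expr0; split; rewrite ?size_poly1 // coef1.
have tA : top 3%N A A`_3 by [].
have tB : top 3%N B B`_3 by [].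
have t0 : top 1%N D0 D0`_1 by [].
have t1 : top 1%N D1 D1`_1 by [].
have t2 : top 1%N D2 D2`_1 by [].
have t3 : top 1%N D3 D3`_1 by [].
have [sG eG] : top 10%N G (- (D0`_1 * B`_3 ^+ 3) + D1`_1 * B`_3 ^+ 2 * A`_3 -
    D2`_1 * B`_3 * A`_3 ^+ 2 + D3`_1 * A`_3 ^+ 3).
  apply: (topD); first (apply: (topD); first apply: (topD)).
  - by apply: topN; apply: (topM 1%N 9%N) => //; apply: (topX 3%N).
  - by apply: (topM 7%N 3%N) => //; apply: (topM 1%N 6%N) => //; apply: (topX 3%N).
  - by apply: topN; apply: (topM 4%N 6%N); [apply: (topM 1%N 3%N)|apply: (topX 3%N)].
  - by apply: (topM 1%N 9%N) => //; apply: (topX 3%N).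
by split=> //; rewrite eG /form13 !binform01; ring.
Qed.
End Lines.

(** * The residue 2-form *)
Definition vol (K : fieldType) (v a b c : 'rV[K]_4) : K := \det (rows4 v a b c).

Section Volume.
Variable K : fieldType.
Implicit Types (v a b c : 'rV[K]_4) (k : K).

Lemma vol_linear0 k v1 v2 a b c :
  vol (k *: v1 + v2) a b c = k * vol v1 a b c + vol v2 a b c.
Proof.
rewrite -[X in _ = _ + X]mul1r; apply: (determinant_multilinear (i0 := 0));
  [apply/rowP => j|apply/matrixP => -[[|[|[|]]] // i] j|apply/matrixP => -[[|[|[|]]] // i] j];
  by rewrite !mxE /= ?mul1r.
Qed.

Lemma vol_linear1 k v a1 a2 b c :
  vol v (k *: a1 + a2) b c = k * vol v a1 b c + vol v a2 b c.
Proof.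
rewrite -[X in _ = _ + X]mul1r; apply: (determinant_multilinear (i0 := 1));
  [apply/rowP => j|apply/matrixP => -[[|[|[|]]] // i] j|apply/matrixP => -[[|[|[|]]] // i] j];
  by rewrite !mxE /= ?mul1r.
Qed.

Lemma vol_linear2 k v a b1 b2 c :
  vol v a (k *: b1 + b2) c = k * vol v a b1 c + vol v a b2 c.
Proof.
rewrite -[X in _ = _ + X]mul1r; apply: (determinant_multilinear (i0 := 2));
  [apply/rowP => j|apply/matrixP => -[[|[|[|]]] // i] j|apply/matrixP => -[[|[|[|]]] // i] j];
  by rewrite !mxE /= ?mul1r.
Qed.

Lemma vol_linear3 k v a b c1 c2 :
  vol v a b (k *: c1 + c2) = k * vol v a b c1 + vol v a b c2.
Proof.
rewrite -[X in _ = _ + X]mul1r; apply: (determinant_multilinear (i0 := 3));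
  [apply/rowP => j|apply/matrixP => -[[|[|[|]]] // i] j|apply/matrixP => -[[|[|[|]]] // i] j];
  by rewrite !mxE /= ?mul1r.
Qed.

Lemma vol_diag01 v b c : vol v v b c = 0.
Proof. by apply: (@determinant_alternate _ _ _ 0 1) => // j; rewrite !mxE. Qed.

Lemma vol_diag12 v a c : vol v a a c = 0.
Proof. by apply: (@determinant_alternate _ _ _ 1 2) => // j; rewrite !mxE. Qed.

Lemma vol_mulmx v a b c (A : 'M[K]_4) :
  vol (v *m A) (a *m A) (b *m A) (c *m A) = vol v a b c * \det A.
Proof.
rewrite /vol -det_mulmx; congr (\det _); apply/matrixP => -[[|[|[|[|]]]] // i] j;
  by rewrite !mxE /= ?mxE; apply: eq_bigr => k _; rewrite mxE.
Qed.

Lemma vol_scale k v a b c : vol (k *: v) (k *: a) (k *: b) (k *: c) = k ^+ 4 * vol v a b c.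
Proof. by rewrite -!mul_mx_scalar vol_mulmx det_scalar mulrC. Qed.

(** Four vectors in a hyperplane are dependent. *)
Lemma vol_eq0 (g : 'cV[K]_4) v a b c : g != 0 ->
  v *m g = 0 -> a *m g = 0 -> b *m g = 0 -> c *m g = 0 -> vol v a b c = 0.
Proof.
move=> g0 hv ha hb hc; apply/eqP; apply: contraNT g0 => d0.
have uM : rows4 v a b c \in unitmx by rewrite unitmxE unitfE.
rewrite -(mulKmx uM g) (_ : _ *m g = 0) ?mulmx0 //.
apply/row_matrixP => i; rewrite row_mul row0.
have : row i (rows4 v a b c) = nth c [:: v; a; b; c] i by apply/rowP => j; rewrite !mxE.
by case: i => -[|[|[|[|]]]] //= _ ->.
Qed.

Definition basis_vec i : 'rV[K]_4 := delta_mx 0 i.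

(** An alternating bilinear form in (a, b) is determined by its values on pairs of
    basis vectors; this is the shape required from a holomorphic 2-form. *)
Lemma vol_expand12 v a b c : vol v a b c =
  \sum_(i < 4) \sum_(j < 4 | (i < j)%N)
    vol v (basis_vec i) (basis_vec j) c * (a 0 i * b 0 j - a 0 j * b 0 i).
Proof.
pose e := basis_vec; pose B i j := vol v (e i) (e j) c.
have ex (u : 'rV[K]_4) : u = \sum_i u 0 i *: e i := row_sum_delta u.
have l1 (s : seq 'I_4) (u w : 'rV[K]_4) : vol v (\sum_(i <- s) u 0 i *: e i) w c =
    \sum_(i <- s) u 0 i * vol v (e i) w c.
  elim: s => [|i s IH]; last by rewrite !big_cons vol_linear1 IH.
  rewrite !big_nil; have := vol_linear1 (-1) v 0 0 w c.
  by rewrite scaleN1r addNr mulN1r addNr.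
have l2 (s : seq 'I_4) (u w : 'rV[K]_4) : vol v w (\sum_(i <- s) u 0 i *: e i) c =
    \sum_(i <- s) u 0 i * vol v w (e i) c.
  elim: s => [|i s IH]; last by rewrite !big_cons vol_linear2 IH.
  rewrite !big_nil; have := vol_linear2 (-1) v w 0 0 c.
  by rewrite scaleN1r addNr mulN1r addNr.
have BN i j : B j i = - B i j.
  have := vol_diag12 v (1 *: e i + e j) c.
  rewrite vol_linear1 !vol_linear2 !vol_diag12 !mul1r add0r addr0 => /eqP.
  by rewrite addr_eq0 => /eqP; rewrite /B => ->; rewrite opprK.
have Bii i : B i i = 0 by apply: vol_diag12.
have low : \sum_(i < 4) \sum_(j < 4 | ~~ (i < j)%N) a 0 i * (b 0 j * B i j) =
    \sum_(i < 4) \sum_(j < 4 | (i < j)%N) - (a 0 j * (b 0 i * B i j)).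
  rewrite [RHS](exchange_big_dep xpredT) //=; apply: eq_bigr => i _.
  rewrite (bigD1 i) ?ltnn //= Bii !mulr0 add0r.
  apply: eq_big => [j|j _]; last by rewrite (BN j i) !mulrN.
  by rewrite -leqNgt ltn_neqAle andbC.
rewrite {1}(ex a) {1}(ex b) l1.
under eq_bigr => i _ do rewrite l2 mulr_sumr (bigID (fun j : 'I_4 => (i < j)%N)) /=.
rewrite big_split /= low -big_split; apply: eq_bigr => i _.
by rewrite -big_split; apply: eq_bigr => j _ /=; rewrite /B; ring.
Qed.
End Volume.

Section Residue.
Variables (K : numFieldType) (F : mpoly 4 K).
Hypothesis hF : smooth_quartic F.

(** The Poincare residue of Omega / F, where Omega is the contraction of the
    volume form with the radial vector: the value at (a, b) is
    vol(v, a, b, c) / dF_v(c) for any c with nonzero dF_v(c), here a basis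
    vector. *)
Definition residue (v a b : 'rV[K]_4) : K :=
  if [pick i | heval (partial i F) v != 0] is Some i
  then vol v a b (basis_vec K i) / heval (partial i F) v else 0.

Lemma dirD_basis v i : dirD F v (basis_vec K i) = heval (partial i F) v.
Proof.
rewrite /dirD (bigD1 i) //= big1 => [|j ji]; first by rewrite mxE !eqxx mul1r addr0.
by rewrite mxE (negbTE ji) andbF mul0r.
Qed.

(** Independence of the choice of c: subtracting a multiple of a basis vector, one
    may assume dF_v(c) = 0, and then v, a, b, c all lie in the kernel of dF_v, v
    by Euler's identity. *)
Lemma residueE v a b c : cone F v -> cone_tangent F v a -> cone_tangent F v b ->
  vol v a b c = residue v a b * dirD F v c.
Proof.
move=> [v0 Fv] ta tb; rewrite /residue; case: pickP => [i gi|g0]; last first.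
  by have [i] := hF.2 v v0 Fv; rewrite g0.
pose g : 'cV[K]_4 := \col_j heval (partial j F) v.
have gE u : dirD F v u = 0 -> u *m g = 0.
  move=> du; apply/matrixP => j k; rewrite !mxE !ord1 -[RHS]du.
  by apply: eq_bigr => l _; rewrite !mxE.
have gn0 : g != 0 by apply: contra gi => /eqP/colP/(_ i); rewrite !mxE => /eqP.
set t := dirD F v c / heval (partial i F) v.
have -> : c = t *: basis_vec K i + (c - t *: basis_vec K i) by rewrite addrC subrK.
rewrite vol_linear3 (@vol_eq0 _ g _ _ _ (c - _)) //; try exact: gE.
- rewrite addr0 dirD_linear dirD_basis.
  have -> : dirD F v (c - t *: basis_vec K i) = 0.
    by rewrite addrC -scaleNr dirD_linear dirD_basis mulNr /t mulfVK // addNr.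
  by rewrite addr0; field.
- by apply: gE; rewrite (euler _ hF.1) Fv mulr0.
- by apply: gE; rewrite addrC -scaleNr dirD_linear dirD_basis mulNr /t mulfVK // addNr.
Qed.

Lemma residue_unique v a b (r : K) : cone F v -> cone_tangent F v a -> cone_tangent F v b ->
  (forall c, vol v a b c = r * dirD F v c) -> residue v a b = r.
Proof.
move=> cv ta tb h; have [i gi] := hF.2 v cv.1 cv.2.
apply: (mulIf gi); rewrite -dirD_basis -h; exact/esym/residueE.
Qed.

Lemma differentiable_heval (G : mpoly 4 K) (v : 'rV[K]_4) :
  differentiable (fun u : 'rV[K]_4 => heval G u : K^o) v.
Proof.
have dcoord i : differentiable (fun u : 'rV[K]_4 => u 0 i : K^o) v.
  exact: differentiable_coord.
elim/mpolyind: G => [|a m G _ _ IH].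
  rewrite (_ : (fun _ => _) = cst 0); first exact: differentiable_cst.
  by apply/funext => u; rewrite /heval meval0.
rewrite (_ : (fun _ => _) = (fun u : 'rV[K]_4 => a *: (heval (mpolyX K m) u : K^o)) +
  (fun u => heval G u : K^o)); last first.
  by apply/funext => u; rewrite /heval mevalD mevalZ.
apply: differentiableD => //; apply: differentiableZ.
rewrite (_ : heval _ = (fun u : 'rV[K]_4 => \prod_i u 0 i ^+ m i : K^o)); last first.
  by apply/funext => u; rewrite /heval mevalX.
elim: (index_enum _) => [|i r IHr].
  rewrite (_ : (fun _ => _) = cst 1); first exact: differentiable_cst.
  by apply/funext => u; rewrite big_nil.
rewrite (_ : (fun _ => _) = (fun u : 'rV[K]_4 => u 0 i ^+ m i : K^o) *
   (fun u : 'rV[K]_4 => \prod_(j <- r) u 0 j ^+ m j : K^o)); last first.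
  by apply/funext => u; rewrite big_cons.
apply: differentiableM => //.
case: (m i) => [|n].
  rewrite (_ : (fun _ => _) = cst 1); first exact: differentiable_cst.
  by apply/funext => u; rewrite expr0.
rewrite (_ : (fun _ => _) = (fun u : 'rV[K]_4 => u 0 i : K^o) ^+ n.+1).
  exact: differentiableX.
by rewrite exprfctE.
Qed.

Lemma differentiable_vol0 (a b c v : 'rV[K]_4) :
  differentiable (fun u : 'rV[K]_4 => vol u a b c : K^o) v.
Proof.
pose G : mpoly 4 K := \sum_i vol (basis_vec K i) a b c *: mpolyX K (mnm1 i).
rewrite (_ : (fun _ => _) = (fun u : 'rV[K]_4 => heval G u : K^o)).
  exact: differentiable_heval.
apply/funext => u; rewrite /heval raddf_sum /= [in LHS](row_sum_delta u).
elim: (index_enum _) => [|i r IH]; last first.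
  by rewrite !big_cons vol_linear0 IH mevalZ mevalXU mulrC.
rewrite !big_nil; have := vol_linear0 (-1) 0 0 a b c.
by rewrite scaleN1r addNr mulN1r addNr.
Qed.

(** Near a point where the k-th partial derivative of F does not vanish, the
    coefficients of the form are vol(v, e_i, e_j, e_k) divided by it.  Scaling v
    multiplies both vol and dF by k^4 when all arguments are scaled, as F has
    degree 4. *)
Lemma residue_holomorphic : holomorphic_2form F residue.
Proof.
split=> [v0 [v0n Fv0]|v b cv tb|k v a b k0 [vn Fv] ta tb].
- have [k gk] := hF.2 v0 v0n Fv0.
  have near_gk : \forall v \near v0, heval (partial k F) v != 0.
    have /differentiable_continuous := differentiable_heval (partial k F) v0.
    by move=> /cvgr_neq0 /(_ gk).
  exists (fun i j v => vol v (basis_vec K i) (basis_vec K j) (basis_vec K k) /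
                        heval (partial k F) v); split=> [i j|].
    near=> v.
    rewrite (_ : (fun _ => _) = (fun u : 'rV[K]_4 =>
      vol u (basis_vec K i) (basis_vec K j) (basis_vec K k) : K^o) *
      (fun u => (heval (partial k F) u : K^o)^-1)) //.
    apply: differentiableM; first exact: differentiable_vol0.
    apply: differentiableV; first exact: differentiable_heval.
    by near: v.
  near=> v => cv a b ta tb.
  have gkv : heval (partial k F) v != 0 by near: v.
  apply: (mulIf gkv); rewrite -{1}dirD_basis -residueE // vol_expand12 mulr_suml.
  apply: eq_bigr => i _; rewrite mulr_suml; apply: eq_bigr => j _.
  by field.
- have tv : cone_tangent F v v by rewrite /cone_tangent /= [LHS](euler _ hF.1) cv.2 mulr0.
  by apply: residue_unique => // c; rewrite vol_diag01 mul0r.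
have dk c : dirD F (k *: v) (k *: c) = k ^+ 4 * dirD F v c.
  have [p [hp <-]] := heval_line v c F.
  rewrite (@dirD_deriv _ _ _ _ (k ^+ 4 *: p)) ?derivZ ?hornerZ // => t.
  by rewrite scalerA mulrC -scalerA -scalerDr (heval_scale _ _ hF.1) hornerZ hp.
apply: residue_unique.
- by split; [rewrite scaler_eq0 negb_or k0|rewrite (heval_scale _ _ hF.1) Fv mulr0].
- by rewrite /cone_tangent /= [LHS]dk [dirD _ _ _]ta mulr0.
- by rewrite /cone_tangent /= [LHS]dk [dirD _ _ _]tb mulr0.
move=> c; have -> : c = k *: (k^-1 *: c) by rewrite scalerA divff // scale1r.
by rewrite vol_scale dk (residueE _ (conj vn Fv) ta tb); ring.
Unshelve. all: by end_near.
Qed.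

Lemma residue_pullback (A : 'M[K]_4) v a b :
  (forall u, heval F (u *m A) = - heval F u) ->
  cone F v -> v *m A != 0 -> cone_tangent F v a -> cone_tangent F v b -> A \in unitmx ->
  residue (v *m A) (a *m A) (b *m A) = - (\det A * residue v a b).
Proof.
move=> FA cv vA ta tb uA.
have dA c : dirD F (v *m A) (c *m A) = - dirD F v c.
  have [p [hp <-]] := heval_line v c F.
  rewrite (@dirD_deriv _ _ _ _ (- p)) ?derivN ?hornerN // => t.
  by rewrite scalemxAl -mulmxDl FA hornerN hp.
apply: residue_unique.
- by split=> //; rewrite FA cv.2 oppr0.
- by rewrite /cone_tangent /= [LHS]dA [dirD _ _ _]ta oppr0.
- by rewrite /cone_tangent /= [LHS]dA [dirD _ _ _]tb oppr0.
move=> c; rewrite -(mulmxKV uA c) vol_mulmx dA (residueE _ cv ta tb).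
by ring.
Qed.
End Residue.

(** * Projectivities and the reflection along two lines *)

Section Projectivities.
Variable K : fieldType.
Implicit Types (A : 'M[K]_4) (p q : P3_point K) (v : 'rV[K]_4).

Lemma mulmx_unit_neq0 A v : A \in unitmx -> v != 0 -> v *m A != 0.
Proof.
by move=> uA; apply: contra => /eqP h; rewrite -(mulmxK uA v) h mul0mx.
Qed.

(** vpick selects a spanning vector; by linearity the image does not depend on it. *)
Definition projectivity A (uA : A \in unitmx) p : P3_point K :=
  point_of (mulmx_unit_neq0 uA (vpick_point_neq0 p)).

Lemma projectivity_lift A (uA : A \in unitmx) : is_lift A (projectivity uA).
Proof.
split=> // p v.
rewrite (point_spanned (vpick_point_neq0 p) (memv_pick _)) => /vlineP[k ->].
by rewrite -scalemxAl /= memvZ // memv_line.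
Qed.

Lemma lift_fixed A tau p v : is_lift A tau -> v != 0 -> v \in val p ->
  tau p = p <-> exists k, v *m A = k *: v.
Proof.
move=> [uA lA] v0 vp; split=> [e|[k e]].
  by have := lA p v vp; rewrite e (point_spanned v0 vp) => /vlineP.
have vA := mulmx_unit_neq0 uA v0.
by apply: (point_eq vA); [exact: lA|rewrite e memvZ].
Qed.

Lemma line_pointsE (l : P3_line K) p v : v != 0 -> v \in val p ->
  line_points l p <-> v \in val l.
Proof. by move=> v0 vp; rewrite /line_points /= (point_spanned v0 vp) -memvE. Qed.

Definition reflection (P : 'M[K]_4) : 'M[K]_4 :=
  invmx P *m diag_mx (vec4 1 1 (-1) (-1)) *m P.

Lemma reflectionE P x y z w : P \in unitmx ->
  vec4 x y z w *m P *m reflection P = vec4 x y (- z) (- w) *m P.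
Proof.
move=> uP; rewrite /reflection !mulmxA mulmxK //; congr (_ *m P).
apply/rowP => j; rewrite mul_mx_diag !mxE.
by case: j => -[|[|[|[|]]]] //= _; rewrite ?mulr1 ?mulrN1.
Qed.

Lemma det_reflection P : P \in unitmx -> \det (reflection P) = 1.
Proof.
move=> uP; rewrite !det_mulmx det_diag mulrAC -det_mulmx mulVmx // det1 mul1r.
by rewrite !big_ord_recl big_ord0 !mxE /= !mul1r mulr1 mulrNN mulr1.
Qed.
End Projectivities.

(** * The equivalence *)

Section Equivalence.
Variables (K : numClosedFieldType) (F : mpoly 4 K) (l1 l2 : P3_line K).
Hypotheses (hF : smooth_quartic F).
Hypotheses (hl1 : line_points l1 `<=` surface F) (hl2 : line_points l2 `<=` surface F).
Hypothesis hdisj : ~ lines_meet l1 l2.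

Lemma frame_splits P : frame (val l1) (val l2) P ->
  exists A B E0 E1 E2 D0 D1 D2 D3, splits (eval_in F P) A B E0 E1 E2 D0 D1 D2 D3.
Proof.
move=> [_ h1 h2]; apply: quartic_splits; first exact: hF.1.
  by move=> x y; apply: ((line_in_surfaceP _ _).1 hl1); rewrite h1 !eqxx.
by move=> z w; apply: ((line_in_surfaceP _ _).1 hl2); rewrite h2 !eqxx.
Qed.

Lemma splits_no22 (f : K -> K -> K -> K -> K) A B E0 E1 E2 D0 D1 D2 D3 :
  splits f A B E0 E1 E2 D0 D1 D2 D3 -> [/\ E0 = 0, E1 = 0 & E2 = 0] ->
  forall x y z w, f x y z w = form31 A B x y z w + form13 D0 D1 D2 D3 x y z w.
Proof.
move=> [_ _ _ hf] [e0 e1 e2] x y z w; rewrite hf /form22 e0 e1 e2 !binform0p.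
by rewrite !mul0r !addr0.
Qed.

Lemma odd_forms A B D0 D1 D2 D3 (x y z w : K) :
  form31 A B x y (- z) (- w) + form13 D0 D1 D2 D3 x y (- z) (- w) =
  - (form31 A B x y z w + form13 D0 D1 D2 D3 x y z w).
Proof. by rewrite /form31 /form13; ring. Qed.

(** At the point e0 of l1 the tangent plane contains l1 and the transversal through
    e0; the residue does not vanish on these two directions because e0, e1,
    (0, 0, -B, A) and (0, 0, z, w) are independent as soon as A z + B w is not
    zero. *)
Lemma residue_neq0 P A B E0 E1 E2 D0 D1 D2 D3 :
  frame (val l1) (val l2) P ->
  splits (eval_in F P) A B E0 E1 E2 D0 D1 D2 D3 ->
  (forall x y z w, eval_in F P x y z w = form31 A B x y z w + form13 D0 D1 D2 D3 x y z w) ->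
  exists v a b, [/\ cone F v, cone_tangent F v a, cone_tangent F v b & residue F v a b != 0].
Proof.
move=> hP hf odd; have uP := frame_unit hP.
pose phi x y z w := vec4 x y z w *m P.
have phi_lin4 := phi_lin P; have [_ h1 h2] := hP.
set a0 := binform 3 A 1 0; set b0 := binform 3 B 1 0.
have ab0 : (- b0, a0) != (0, 0) by apply: (AB_neq0 hF hP hf); exact: affine_neq0.
exists (phi 1 0 0 0), (phi 0 1 0 0), (phi 0 0 (- b0) a0).
have cv : cone F (phi 1 0 0 0).
  split; first by apply/eqP => /(vec4_inj uP)[/eqP]; rewrite oner_eq0.
  by apply: ((line_in_surfaceP _ _).1 hl1); rewrite h1 !eqxx.
have ta : cone_tangent F (phi 1 0 0 0) (phi 0 1 0 0).
  rewrite /cone_tangent /= [LHS](@dirD_deriv _ _ _ _ 0) ?deriv0 ?horner0 // => t.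
  rewrite horner0; apply: ((line_in_surfaceP _ _).1 hl1).
  by apply: memvD; rewrite ?memvZ ?h1 ?eqxx.
have tb : cone_tangent F (phi 1 0 0 0) (phi 0 0 (- b0) a0).
  rewrite /cone_tangent /= [LHS](@dirD_deriv _ _ _ _ (form13 D0 D1 D2 D3 1 0 (- b0) a0 *: 'X^3)).
    by rewrite derivZ derivXn !evalE; ring.
  move=> t; rewrite -[X in X + _]scale1r phi_lin4 [LHS]odd /form31 /form13.
  rewrite !mulr0 !mulr1 !addr0 !add0r -/a0 -/b0 !evalE; ring.
split=> //; apply/eqP => r0.
have [z [w zw]] : exists z w, b0 * w + a0 * z != 0.
  have [e|a00] := eqVneq a0 0; last by exists 1, 0; rewrite mulr0 add0r mulr1.
  exists 0, 1; rewrite mulr0 addr0 mulr1.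
  by apply: contra ab0 => /eqP ->; rewrite e oppr0.
have : vol (phi 1 0 0 0) (phi 0 1 0 0) (phi 0 0 (- b0) a0) (phi 0 0 z w) != 0.
  rewrite vol_mulmx mulf_neq0 //; last by rewrite -unitfE -unitmxE.
  rewrite -unitfE -unitmxE; apply: rows4_unit => x y s t /rowP h.
  have := h 0; have := h 1; have := h 2; have := h 3; rewrite !mxE /=.
  rewrite !mulr0 !mulr1 !addr0 !add0r => e3 e2 -> ->.
  have t0 : t = 0.
    apply: (mulfI zw); rewrite mulr0.
    transitivity (b0 * (s * a0 + t * w) + a0 * (s * - b0 + t * z)).
      by rewrite /a0 /b0; ring.
    by rewrite e3 e2 !mulr0 addr0.
  move: e3 e2; rewrite t0 !mul0r !addr0 mulrN => e3 /eqP; rewrite oppr_eq0 => /eqP e2.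
  split=> //; apply/eqP; apply: contraNT ab0 => s0.
  by move/eqP: e3; move/eqP: e2; rewrite !mulf_eq0 (negbTE s0) /= => /eqP -> /eqP ->; rewrite oppr0.
by rewrite (residueE hF _ cv ta tb) r0 mul0r eqxx.
Qed.

(** The reflection along the two lines is anti-invariant for F; a moved point of the
    surface is found on any of the ten lines. *)
Lemma twin_lines_involution : twin_lines (surface F) l1 l2 ->
  exists tau : P3_point K -> P3_point K,
    [/\ symmetry (surface F) tau, ~ symplectic F tau, has_order2 (surface F) tau,
        Fix tau (surface F) = line_points l1 `|` line_points l2 &
        Fix tau setT = line_points l1 `|` line_points l2].
Proof.
move=> tw; have [P hP] := frame_exists hdisj; have uP := frame_unit hP.
have [A [B [E0 [E1 [E2 [D0 [D1 [D2 [D3 hf]]]]]]]]] := frame_splits hP.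
have odd := splits_no22 hf (twin_form22_eq0 hF hP hf tw).
have dS := det_reflection uP; set S := reflection P in dS.
have uS : S \in unitmx by rewrite unitmxE dS unitr1.
have FS u : heval F (u *m S) = - heval F u.
  have [x [y [z [w ->]]]] := frame_coord hP u.
  by rewrite reflectionE // [LHS]odd odd_forms [heval _ _]odd.
have SS (u : 'rV[K]_4) : u *m S *m S = u.
  have [x [y [z [w ->]]]] := frame_coord hP u.
  by rewrite !reflectionE // !opprK.
pose tau := projectivity uS; have lS : is_lift S tau := projectivity_lift uS.
have tautau p : tau (tau p) = p.
  have [v v0 vp] := pointP p; apply: (point_eq v0 _ vp).
  by rewrite -(SS v); apply: lS.2; apply: lS.2.
have tauX p : surface F p -> surface F (tau p).
  move=> Xp v; have [u u0 up] := pointP p.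
  rewrite (point_spanned (mulmx_unit_neq0 uS u0) (lS.2 _ _ up)) => /vlineP[k ->].
  by rewrite scalemxAl FS Xp ?oppr0 // memvZ.
have fixT : Fix tau setT = line_points l1 `|` line_points l2.
  apply/seteqP; split=> p; have [v v0 vp] := pointP p;
    have [x [y [z [w ev]]]] := frame_coord hP v; have [_ h1 h2] := hP.
    move=> [_ /(lift_fixed lS v0 vp)[k]]; rewrite ev reflectionE // phiZ.
    move=> /(phi_inj hP)[ex ey ez ew].
    have [k1|k1] := eqVneq k 1.
      left; apply/(line_pointsE _ v0 vp); rewrite ev h1 -!eqNr.
      by rewrite ez ew k1 !mul1r !eqxx.
    right; apply/(line_pointsE _ v0 vp); rewrite ev h2.
    have fixed0 t : t = k * t -> t == 0.
      move=> /eqP; rewrite -subr_eq0 -{1}[t]mul1r -mulrBl mulf_eq0 subr_eq0.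
      by rewrite eq_sym (negbTE k1).
    by rewrite !fixed0.
  move=> pl; split=> //; apply/(lift_fixed lS v0 vp).
  case: pl => /(line_pointsE _ v0 vp); rewrite ev ?h1 ?h2 => /andP[/eqP -> /eqP ->].
    by exists 1; rewrite reflectionE // !oppr0 scale1r.
  by exists (-1); rewrite reflectionE // phiZ !mulN1r !oppr0.
have fixX : Fix tau (surface F) = line_points l1 `|` line_points l2.
  rewrite -fixT; apply/seteqP; split=> p [Xp tp]; split=> //.
  have : (line_points l1 `|` line_points l2) p by rewrite -fixT.
  by case=> [/hl1|/hl2].
exists tau; split=> //.
- split; first by exists S.
  apply/seteqP; split=> [_ [p Xp <-]|p Xp]; first exact: tauX.
  by exists (tau p); [exact: tauX|exact: tautau].
- move=> symp; have [v [a [b [cv ta tb /eqP r0]]]] := residue_neq0 hP hf odd.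
  apply: r0; apply/eqP; rewrite -eqNr -{1}(mul1r (residue _ _ _ _)) -dS.
  rewrite -(residue_pullback hF FS cv (mulmx_unit_neq0 uS cv.1) ta tb uS).
  by rewrite (symp S lS _ (residue_holomorphic hF)).
- split=> [p _|]; first exact: tautau.
  have [_ _ _ [s [_ hs]]] := tw.
  have [_ _ /line_in_surfaceP Fm /lines_meetP[u [u0 um u1]] /lines_meetP[v [v0 vm v2]]] :=
    hs _ (mem_tnth ord0 s).
  have uv0 : u + v != 0.
    apply/eqP => /eqP; rewrite addr_eq0 => /eqP uv; apply: hdisj; apply/lines_meetP.
    by exists u; split=> //; rewrite uv memvN.
  exists (point_of uv0) => [k /vlineP[c ->]|].
    by apply: Fm; apply: memvZ; apply: memvD.
  have puv : u + v \in val (point_of uv0) by exact: memv_line.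
  move=> tp; have : (line_points l1 `|` line_points l2) (point_of uv0) by rewrite -fixT.
  case=> /(line_pointsE _ uv0 puv) h; apply: hdisj; apply/lines_meetP.
    by exists v; split=> //; rewrite -(rpredDl _ u1).
  by exists u; split=> //; rewrite -(rpredDr _ v2).
Qed.

(** All vectors of the plane carrying l are eigenvectors, so the eigenvalues of two
    basis vectors agree with that of their sum. *)
Lemma line_eigenvalue (l : P3_line K) (A : 'M[K]_4) tau : is_lift A tau ->
  (forall p, line_points l p -> tau p = p) ->
  exists k, forall v, v \in val l -> v *m A = k *: v.
Proof.
move=> lA fix_l; have [a [b [el free_ab]]] := line_basis l.
have eig v : v != 0 -> v \in val l -> exists k, v *m A = k *: v.
  move=> v0 vl; have vp : v \in val (point_of v0) by exact: memv_line.
  by apply/(lift_fixed lA v0 vp)/fix_l/(line_pointsE l v0 vp).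
have mem s t : s *: a + t *: b \in val l by rewrite el; apply/mem_join; exists s, t.
have neq0 s t : (s, t) != (0, 0) -> s *: a + t *: b != 0.
  by apply: contra => /eqP/free_ab[-> ->].
have eig2 s t : (s, t) != (0, 0) :> K * K ->
    exists k, (s *: a + t *: b) *m A = k *: (s *: a + t *: b).
  by move=> st; apply: eig => //; apply: neq0.
have [|k1] := eig2 1 0; first by rewrite xpair_eqE oner_eq0.
rewrite scale0r addr0 scale1r => e1.
have [|k2] := eig2 0 1; first by rewrite xpair_eqE oner_eq0 andbF.
rewrite scale0r add0r scale1r => e2.
have [|k3] := eig2 1 1; first by rewrite xpair_eqE oner_eq0.
rewrite !scale1r mulmxDl e1 e2 => e3.
have [k13 k23] : k1 - k3 = 0 /\ k2 - k3 = 0.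
  by apply: free_ab; rewrite !scalerBl addrACA -opprD -scalerDr e3 subrr.
exists k3 => v; rewrite el => /mem_join[s [t ->]].
rewrite mulmxDl -!scalemxAl e1 e2 (subr0_eq k13) (subr0_eq k23).
by rewrite scalerDr !scalerA ![k3 * _]mulrC.
Qed.

(** A lift acts as k1 on the first plane and as k2 on the second.  A moved point of
    order 2 has nonzero components in both, whence k1^2 = k2^2; and k1 differs from
    k2 since the point is moved. *)
Lemma involution_invariant P tau : frame (val l1) (val l2) P ->
  symmetry (surface F) tau -> has_order2 (surface F) tau ->
  Fix tau setT = line_points l1 `|` line_points l2 ->
  forall x y z w, eval_in F P x y z w = 0 -> eval_in F P x y (- z) (- w) = 0.
Proof.
move=> hP [[A lA] tauX] [tt2 [p Xp tp]] fixT; have uP := frame_unit hP.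
have [k1 e1] : exists k, forall v, v \in val l1 -> v *m A = k *: v.
  apply: line_eigenvalue lA _ => q ql.
  by have [] : Fix tau setT q by rewrite fixT; left.
have [k2 e2] : exists k, forall v, v \in val l2 -> v *m A = k *: v.
  apply: line_eigenvalue lA _ => q ql.
  by have [] : Fix tau setT q by rewrite fixT; right.
have [_ h1 h2] := hP.
have eA x y z w : vec4 x y z w *m P *m A = vec4 (k1 * x) (k1 * y) (k2 * z) (k2 * w) *m P.
  have -> : vec4 x y z w *m P = 1 *: (vec4 x y 0 0 *m P) + 1 *: (vec4 0 0 z w *m P).
    by rewrite phi_lin; congr (vec4 _ _ _ _ *m _); ring.
  rewrite !scale1r mulmxDl e1 ?h1 ?eqxx // e2 ?h2 ?eqxx // phi_lin.
  by congr (vec4 _ _ _ _ *m _); ring.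
have k12 : k2 = - k1.
  have [v v0 vp] := pointP p; have [x [y [z [w ev]]]] := frame_coord hP v.
  have tp2 : tau (tau p) = p := tt2 p Xp.
  have : v *m A *m A \in val p by rewrite -tp2; apply: lA.2; apply: lA.2.
  rewrite (point_spanned v0 vp) => /vlineP[k].
  rewrite ev !eA phiZ => /(phi_inj hP); rewrite !mulrA => -[ex ey ez ew].
  have nk : k1 != k2.
    apply: contra_notN tp => /eqP k12; apply/(lift_fixed lA v0 vp); exists k1.
    by rewrite ev eA phiZ k12.
  have not1 : ~ (v \in val l1) by move=> /e1 h; apply: tp; apply/(lift_fixed lA v0 vp); exists k1.
  have not2 : ~ (v \in val l2) by move=> /e2 h; apply: tp; apply/(lift_fixed lA v0 vp); exists k2.
  have cancel (a b c : K) : a != b -> a * c = b * c -> c == 0.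
    by move=> ab /eqP; rewrite -subr_eq0 -mulrBl mulf_eq0 subr_eq0 (negbTE ab).
  have sq1 : k1 * k1 = k.
    apply: contrapT => /eqP ne; apply: not2.
    by rewrite ev h2 (cancel _ _ _ ne ex) (cancel _ _ _ ne ey).
  have sq2 : k2 * k2 = k.
    apply: contrapT => /eqP ne; apply: not1.
    by rewrite ev h1 (cancel _ _ _ ne ez) (cancel _ _ _ ne ew).
  have /eqP : (k1 - k2) * (k2 + k1) = 0.
    by transitivity (k1 * k1 - k2 * k2); [ring|rewrite sq1 sq2 subrr].
  by rewrite mulf_eq0 subr_eq0 (negbTE nk) /= addr_eq0 => /eqP.
have k10 : k1 != 0.
  apply/eqP => k10; have := eA 1 0 0 0.
  rewrite k12 k10 oppr0 !mul0r phi0 => /eqP; apply/negP/mulmx_unit_neq0; first exact: lA.1.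
  by apply/eqP => /(vec4_inj uP)[/eqP]; rewrite oner_eq0.
move=> x y z w f0; set v := vec4 x y z w *m P in f0.
have [v0|v0] := eqVneq v 0.
  by have [-> -> -> ->] := vec4_inj uP v0; rewrite oppr0 /eval_in phi0 -v0.
have Xv : surface F (point_of v0).
  by move=> u /vlineP[k ->]; rewrite (heval_scale _ _ hF.1) [heval F v]f0 mulr0.
have : surface F (tau (point_of v0)) by rewrite -tauX; exists (point_of v0).
move=> /(_ (v *m A)) h; have := h (lA.2 (point_of v0) v (memv_line v)).
rewrite /v eA k12 !mulNr -!mulrN -phiZ (heval_scale _ _ hF.1) => /eqP.
by rewrite mulf_eq0 expf_eq0 (negbTE k10) /= => /eqP.
Qed.

(** The resultant has degree 10 only if no transversal on the surface passes through
    the point of l1 at infinity.  A point c at which the resultant in a first frame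
    does not vanish is thus moved to infinity. *)
Lemma involution_twin_lines (tau : P3_point K -> P3_point K) :
  symmetry (surface F) tau -> has_order2 (surface F) tau ->
  Fix tau setT = line_points l1 `|` line_points l2 ->
  twin_lines (surface F) l1 l2.
Proof.
move=> sym ord2 fixT; have [P hP] := frame_exists hdisj; have uP := frame_unit hP.
have [A [B [E0 [E1 [E2 [D0 [D1 [D2 [D3 hf]]]]]]]]] := frame_splits hP.
have e22 := form22_eq0_of_invariant hF uP hf (involution_invariant hP sym ord2 fixT).
have odd := splits_no22 hf e22.
have [c Gc] : exists c, (resultant_poly A B D0 D1 D2 D3).[c] != 0.
  apply: contrapT => none; have /eqP := resultant_neq0 hF hP hf odd; apply.
  apply: horner_inj => t; rewrite horner0; apply: contrapT => /eqP ht.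
  by apply: none; exists t.
have [P' [hP' eP']] := frame_shear c hP.
have [A' [B' [E0' [E1' [E2' [D0' [D1' [D2' [D3' hf']]]]]]]]] := frame_splits hP'.
have odd' : forall x y z w, eval_in F P' x y z w =
    form31 A' B' x y z w + form13 D0' D1' D2' D3' x y z w.
  apply: (splits_odd hf') => x y z w; rewrite /eval_in !eP'.
  by rewrite [LHS]odd odd_forms; congr (- _); exact/esym/odd.
apply: (twin_of_odd hF hP' hf' odd' hl1 hl2 hdisj).
have [sG lead] := resultant_lead hf'.
apply/eqP; rewrite eqn_leq sG ltnNge; apply: contra Gc => sG'.
have inf0 : (0, 1) != (0, 0) :> K * K by rewrite xpair_eqE oner_eq0 andbF.
pose m : P3_line K := exist _ (transversal P' A' B' 0 1) (dim_transversal hF hP' hf' inf0).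
apply/eqP/(@resultant_root_of_line _ _ _ _ _ hF hP _ _ _ _ _ _ _ _ _ hf odd m).
- move=> v; apply: (transversal_in_surface odd').
  by rewrite -lead nth_default.
- rewrite /m /=; apply/mem_join; exists 1, 0; rewrite phi_lin eP'.
  by congr (vec4 _ _ _ _ *m _); ring.
apply/lines_meetP; exists (vec4 0 0 (- binform 3 B' 0 1) (binform 3 A' 0 1) *m P').
have [_ _ h2] := hP'; split; last by rewrite h2 !eqxx.
  apply: contra (AB_neq0 hF hP' hf' inf0) => /eqP h.
  by have [_ _ -> ->] := vec4_inj (frame_unit hP') h.
by apply/mem_join; exists 0, 1; rewrite scale0r add0r scale1r.
Qed.
End Equivalence.

Theorem proposition4p3 (R : realType) (F : mpoly 4 (Cplx R))
    (hF : smooth_quartic F) (l1 l2 : P3_line (Cplx R))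
    (hl1 : line_points l1 `<=` surface F)
    (hl2 : line_points l2 `<=` surface F)
    (hdisj : ~ lines_meet l1 l2) :
  twin_lines (surface F) l1 l2 <->
  exists tau : P3_point (Cplx R) -> P3_point (Cplx R),
    [/\ symmetry (surface F) tau,
        ~ symplectic F tau,
        has_order2 (surface F) tau,
        Fix tau (surface F) = line_points l1 `|` line_points l2 &
        Fix tau setT = line_points l1 `|` line_points l2].
Proof.
split; first exact: twin_lines_involution.
by move=> [tau [sym _ ord2 _ fixT]]; exact: (involution_twin_lines _ _ _ _ sym).
Qed.
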